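(* Let $R$ be a local $\mathbb C$-affine domain and let $I$ be an ideal of $R$ generated by $n\ge 1$ elements. Then for every $k\in\mathbb N$ (including $k=0$), the integral closure of $I^{n+k}$ is contained in $I^{k+1}\mathcal B(R)\cap R$.
   Context: A $\mathbb C$-affine algebra is a finitely generated $\mathbb C$-algebra or a localization of such an algebra at a prime ideal; in the latter case it is called local $\mathbb C$-affine. Fix a non-principal ultrafilter on the set of prime numbers; ''almost all $p$'' and ultraproducts $\operatorname{ulim}_p$ are with respect to it. Fix a field isomorphism $\mathbb C\cong\operatorname{ulim}_p\mathbb F_p^{\rm alg}$ ($\mathbb F_p^{\rm alg}$ the algebraic closure of $\mathbb F_p$). An approximation of $c\in\mathbb C$ is a sequence $c_p\in\mathbb F_p^{\rm alg}$ with $\operatorname{ulim}_p c_p=c$; an approximation of a polynomial $f\in\mathbb C[X]$ ($X$ a finite tuple of variables) is the sequence $f_p\in\mathbb F_p^{\rm alg}[X]$ obtained by approximating each coefficient; an approximation of an ideal is the sequence of ideals generated by approximations of a finite generating set. An approximation of $R=\mathbb C[X]/I$ (respectively of its localization at a prime ideal $\mathfrak p$) is the sequence $R_p=\mathbb F_p^{\rm alg}[X]/I_p$ (respectively its localization at $\mathfrak p_p$, which is prime for almost all $p$). It is unique up to isomorphism for almost all $p$; if $R$ is a domain, so are almost all $R_p$. The non-standard hull of $R$ is $R_\infty=\operatorname{ulim}_pR_p$, with natural map $R\to R_\infty$ sending an element to the ultraproduct of an approximation of it. For a domain $A$, $A^+$ is the integral closure of $A$ in an algebraic closure of its fraction field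 (and $A^+=0$ if $A$ is not a domain). For a $\mathbb C$-affine domain $R$, $\mathcal B(R):=\operatorname{ulim}_pR_p^+$, an $R$-algebra via $R\to R_\infty\to\mathcal B(R)$; it is unique up to $R$-algebra isomorphism. For an ideal $J$ of $R$, $J\mathcal B(R)\cap R$ denotes the preimage of $J\mathcal B(R)$ in $R$. *)

(* Defs.v *)
From HB Require Import structures.
From mathcomp Require Import all_boot all_order all_algebra.
From mathcomp Require Import generic_quotient fraction complex mpoly ring.
From mathcomp Require Import boolp classical_sets filter reals.

Set Implicit Arguments.
Unset Strict Implicit.
Unset Printing Implicit Defensive.

Import Order.TTheory GRing.Theory Num.Theory.
Local Open Scope classical_set_scope.
Local Open Scope ring_scope.
Local Open Scope quotient_scope.

(** The library's [idealr] and ideal quotients only cover proper ideals; the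
    rings below may be zero at exceptional primes, hence [comPzRingType]. *)

Section Ideals.
Variable A : comPzRingType.

Record ideal := Ideal {
  ideal_set :> A -> Prop;
  ideal_0 : ideal_set 0;
  ideal_D : forall x y, ideal_set x -> ideal_set y -> ideal_set (x + y);
  ideal_M : forall a x, ideal_set x -> ideal_set (a * x) }.

Definition gen_set (S : set A) : set A :=
  [set x | exists (n : nat) (c s : 'I_n -> A),
     (forall i, S (s i)) /\ x = \sum_i c i * s i].

Lemma gen_set0 S : gen_set S 0.
Proof. by exists 0, (fun=> 0), (fun=> 0); split=> [[]|]//; rewrite big_ord0. Qed.

Lemma gen_setD S x y : gen_set S x -> gen_set S y -> gen_set S (x + y).
Proof.
move=> [n [c [s [Ss ->]]]] [m [d [t [St ->]]]].
exists (n + m)%N,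
  (fun i => match split i with inl j => c j | inr j => d j end),
  (fun i => match split i with inl j => s j | inr j => t j end).
split=> [i|]; first by case: (split i).
rewrite big_split_ord /=; congr (_ + _); apply: eq_bigr => i _.
- by rewrite (unsplitK (inl i)).
- by rewrite (unsplitK (inr i)).
Qed.

Lemma gen_setM S a x : gen_set S x -> gen_set S (a * x).
Proof.
move=> [n [c [s [Ss ->]]]]; exists n, (fun i => a * c i), s; split=> //.
by rewrite mulr_sumr; apply: eq_bigr => i _; rewrite mulrA.
Qed.

Definition ideal_gen S : ideal :=
  Ideal (gen_set0 S) (@gen_setD S) (@gen_setM S).

(* For [k = 0] the only generator is the empty product, so [J^0 = A]. *)
Definition ideal_pow (J : ideal) (k : nat) : ideal :=
  ideal_gen [set x | exists2 s : 'I_k -> A,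
    (forall i, J (s i)) & x = \prod_i s i].

Definition prime_ideal (J : ideal) : Prop :=
  ~ J 1 /\ (forall x y, J (x * y) -> J x \/ J y).

Definition integral_closure (J : ideal) : set A :=
  [set z | exists (d : nat) (a : nat -> A),
    [/\ (0 < d)%N,
        forall i, (1 <= i <= d)%N -> ideal_pow J i (a i) &
        z ^+ d + \sum_(1 <= i < d.+1) a i * z ^+ (d - i) = 0]].

Definition is_domain : Prop :=
  1 <> 0 :> A /\ (forall x y : A, x * y = 0 -> x = 0 \/ y = 0).

End Ideals.

Definition ideal_ext (A B : comPzRingType) (f : A -> B) (J : ideal A) :
  ideal B := ideal_gen (f @` ideal_set J).

Section Quotient.
Variables (A : comPzRingType) (I : ideal A).
Implicit Types x y z : A.

Definition qeq x y := `[< I (x - y) >].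

Fact ideal_N x : I x -> I (- x).
Proof. by move=> Ix; rewrite -mulN1r; apply: ideal_M. Qed.

Fact qeq_refl : reflexive qeq.
Proof. by move=> x; apply/asboolP; rewrite subrr; apply: ideal_0. Qed.

Fact qeq_sym : ssrbool.symmetric qeq.
Proof.
move=> x y; apply/asboolP/asboolP => /ideal_N; by rewrite opprB.
Qed.

Fact qeq_trans : transitive qeq.
Proof.
move=> y x z /asboolP Ixy /asboolP Iyz; apply/asboolP.
by rewrite -(subrKA y); apply: ideal_D.
Qed.

Canonical qeq_equiv := EquivRel qeq qeq_refl qeq_sym qeq_trans.

Definition Quot := {eq_quot qeq_equiv}.
HB.instance Definition _ := Choice.on Quot.

Definition qpi (x : A) : Quot := \pi_{eq_quot qeq_equiv} x.

Lemma qpiP x y : qpi x = qpi y <-> I (x - y).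
Proof.
split=> [/eqP|Ixy]; first by rewrite /qpi eqmodE => /asboolP.
by apply/eqP; rewrite /qpi eqmodE; apply/asboolP.
Qed.

Definition qrepr (u : Quot) : A := repr (u : {eq_quot qeq_equiv}).

Lemma qreprK u : qpi (qrepr u) = u.
Proof. exact: reprK. Qed.

Definition q0 : Quot := qpi 0.
Definition q1 : Quot := qpi 1.
Definition qopp (u : Quot) : Quot := qpi (- qrepr u).
Definition qadd (u v : Quot) : Quot := qpi (qrepr u + qrepr v).
Definition qmul (u v : Quot) : Quot := qpi (qrepr u * qrepr v).

Lemma qrepr_pi x : I (qrepr (qpi x) - x).
Proof. by apply/qpiP; rewrite qreprK. Qed.

Lemma qoppE x : qopp (qpi x) = qpi (- x).
Proof. by apply/qpiP; rewrite -opprD; apply/ideal_N/qrepr_pi. Qed.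

Lemma qaddE x y : qadd (qpi x) (qpi y) = qpi (x + y).
Proof.
by apply/qpiP; rewrite opprD addrACA; apply: ideal_D; apply: qrepr_pi.
Qed.

Lemma qmulE x y : qmul (qpi x) (qpi y) = qpi (x * y).
Proof.
apply/qpiP; rewrite -(subrKA (x * qrepr (qpi y))) -mulrBl -mulrBr.
by rewrite mulrC; apply: ideal_D; apply: ideal_M; apply: qrepr_pi.
Qed.

Fact qaddA : associative qadd.
Proof.
by move=> u v w; rewrite -(qreprK u) -(qreprK v) -(qreprK w) !qaddE addrA.
Qed.
Fact qaddC : commutative qadd.
Proof. by move=> u v; rewrite -(qreprK u) -(qreprK v) !qaddE addrC. Qed.
Fact qadd0 : left_id q0 qadd.
Proof. by move=> u; rewrite -(qreprK u) qaddE add0r. Qed.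
Fact qaddN : left_inverse q0 qopp qadd.
Proof. by move=> u; rewrite -(qreprK u) qoppE qaddE addNr. Qed.
HB.instance Definition _ := GRing.isZmodule.Build Quot qaddA qaddC qadd0 qaddN.

Fact qmulA : associative qmul.
Proof.
by move=> u v w; rewrite -(qreprK u) -(qreprK v) -(qreprK w) !qmulE mulrA.
Qed.
Fact qmulC : commutative qmul.
Proof. by move=> u v; rewrite -(qreprK u) -(qreprK v) !qmulE mulrC. Qed.
Fact qmul1 : left_id q1 qmul.
Proof. by move=> u; rewrite -(qreprK u) qmulE mul1r. Qed.
Fact qmulDl : left_distributive qmul qadd.
Proof.
move=> u v w; rewrite -(qreprK u) -(qreprK v) -(qreprK w).
by rewrite qaddE !qmulE mulrDl qaddE.
Qed.
HB.instance Definition _ :=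
  GRing.Zmodule_isComPzRing.Build Quot qmulA qmulC qmul1 qmulDl.

Fact qpi_zmod : zmod_morphism qpi.
Proof. by move=> x y; rewrite -qaddE -qoppE. Qed.
Fact qpi_monoid : monoid_morphism qpi.
Proof. by split=> // x y; rewrite -qmulE. Qed.
HB.instance Definition _ := GRing.isZmodMorphism.Build A Quot qpi qpi_zmod.
HB.instance Definition _ := GRing.isMonoidMorphism.Build A Quot qpi qpi_monoid.

End Quotient.

(** Denominators of [Loc P] range over the monoid generated by the complement of [P]: this
    is the complement itself when [P] is prime, and it lets the ring be formed
    for every [P] (as needed at the exceptional primes of an approximation). *)

Section Localization.
Variables (A : comPzRingType) (P : ideal A).

Definition denom : set A :=
  [set s | exists2 l : seq A, (forall x, x \in l -> ~ P x) &
    s = \prod_(x <- l) x].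

Lemma denom1 : denom 1.
Proof. by exists [::] => //; rewrite big_nil. Qed.

Lemma denomM s t : denom s -> denom t -> denom (s * t).
Proof.
move=> [l Pl ->] [l' Pl' ->]; exists (l ++ l'); last by rewrite big_cat.
by move=> x; rewrite mem_cat => /orP[/Pl|/Pl'].
Qed.

Lemma denom_prime s : prime_ideal P -> denom s <-> ~ P s.
Proof.
move=> [P1 PM]; split=> [[l Pl ->]|Ps].
  elim: l Pl => [|x l IH] Pl; first by rewrite big_nil.
  rewrite big_cons => /PM[]; first by apply: Pl; rewrite mem_head.
  by apply: IH => y ly; apply: Pl; rewrite inE ly orbT.
exists [:: s]; last by rewrite big_seq1.
by move=> x; rewrite inE => /eqP->.
Qed.

Definition den := {s : A | `[< denom s >]}.

Fact den_val (s : den) : denom (val s).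
Proof. exact: (asboolW (valP s)). Qed.

Fact den_M (s t : den) : `[< denom (val s * val t) >].
Proof. by apply/asboolP/denomM; apply: den_val. Qed.
Definition denmul (s t : den) : den := exist _ (val s * val t) (den_M s t).
Definition den1 : den := exist _ 1 (introT (asboolP _) denom1).

Fact denmulE s t : val (denmul s t) = val s * val t. Proof. by []. Qed.
Fact den1E : val den1 = 1. Proof. by []. Qed.

Definition feq (x y : A * den) :=
  `[< exists2 u, denom u & u * (x.1 * val y.2) = u * (y.1 * val x.2) >].

Fact feq_refl : reflexive feq.
Proof. by move=> x; apply/asboolP; exists 1 => //; exact: denom1. Qed.

Fact feq_sym : ssrbool.symmetric feq.
Proof. by move=> x y; apply/asboolP/asboolP => -[u Du E]; exists u. Qed.

Fact feq_trans : transitive feq.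
Proof.
move=> y x z /asboolP[u Du E] /asboolP[v Dv F]; apply/asboolP.
exists (u * v * val y.2); first by apply: denomM (den_val _); apply: denomM.
transitivity (v * val z.2 * (u * (x.1 * val y.2))); first by ring.
rewrite E.
transitivity (u * val x.2 * (v * (y.1 * val z.2))); first by ring.
by rewrite F; ring.
Qed.

Canonical feq_equiv := EquivRel feq feq_refl feq_sym feq_trans.

Definition Loc := {eq_quot feq_equiv}.
HB.instance Definition _ := Choice.on Loc.

Definition lpi (x : A * den) : Loc := \pi_{eq_quot feq_equiv} x.
Definition lrepr (u : Loc) : A * den := repr (u : {eq_quot feq_equiv}).

Lemma lreprK u : lpi (lrepr u) = u.
Proof. exact: reprK. Qed.

Lemma lpiP x y : lpi x = lpi y <->
  exists2 u, denom u & u * (x.1 * val y.2) = u * (y.1 * val x.2).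
Proof.
split=> [/eqP|E]; first by rewrite /lpi eqmodE => /asboolP.
by apply/eqP; rewrite /lpi eqmodE; apply/asboolP.
Qed.

Definition fadd (x y : A * den) : A * den :=
  (x.1 * val y.2 + y.1 * val x.2, denmul x.2 y.2).
Definition fmul (x y : A * den) : A * den := (x.1 * y.1, denmul x.2 y.2).
Definition fopp (x : A * den) : A * den := (- x.1, x.2).

Local Ltac fring :=
  rewrite /fadd /fmul /fopp; cbn [fst snd]; rewrite ?denmulE ?den1E; ring.

Definition l0 : Loc := lpi (0, den1).
Definition l1 : Loc := lpi (1, den1).
Definition lopp (u : Loc) : Loc := lpi (fopp (lrepr u)).
Definition ladd (u v : Loc) : Loc := lpi (fadd (lrepr u) (lrepr v)).
Definition lmul (u v : Loc) : Loc := lpi (fmul (lrepr u) (lrepr v)).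

Fact lrepr_pi x : exists2 u, denom u &
  u * ((lrepr (lpi x)).1 * val x.2) = u * (x.1 * val (lrepr (lpi x)).2).
Proof. by apply/lpiP; rewrite lreprK. Qed.

Fact loppE x : lopp (lpi x) = lpi (fopp x).
Proof.
have [u Du E] := lrepr_pi x; apply/lpiP; exists u => //.
by transitivity (- (u * ((lrepr (lpi x)).1 * val x.2))); [fring | rewrite E; fring].
Qed.

Fact laddE x y : ladd (lpi x) (lpi y) = lpi (fadd x y).
Proof.
have [u Du E] := lrepr_pi x; have [v Dv F] := lrepr_pi y.
apply/lpiP; exists (u * v); first exact: denomM.
move: (lrepr (lpi x)) (lrepr (lpi y)) E F => x' y' E F.
transitivity (v * val y.2 * val y'.2 * (u * (x'.1 * val x.2))
  + u * val x.2 * val x'.2 * (v * (y'.1 * val y.2))); first by fring.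
by rewrite E F; fring.
Qed.

Fact lmulE x y : lmul (lpi x) (lpi y) = lpi (fmul x y).
Proof.
have [u Du E] := lrepr_pi x; have [v Dv F] := lrepr_pi y.
apply/lpiP; exists (u * v); first exact: denomM.
move: (lrepr (lpi x)) (lrepr (lpi y)) E F => x' y' E F.
transitivity ((u * (x'.1 * val x.2)) * (v * (y'.1 * val y.2))); first by fring.
by rewrite E F; fring.
Qed.

Fact laddA : associative ladd.
Proof.
move=> u v w; rewrite -(lreprK u) -(lreprK v) -(lreprK w) !laddE.
by apply/lpiP; exists 1; [exact: denom1 | rewrite /=; ring].
Qed.
Fact laddC : commutative ladd.
Proof.
move=> u v; rewrite -(lreprK u) -(lreprK v) !laddE.
by apply/lpiP; exists 1; [exact: denom1 | rewrite /=; ring].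
Qed.
Fact ladd0 : left_id l0 ladd.
Proof.
move=> u; rewrite -(lreprK u) laddE.
by apply/lpiP; exists 1; [exact: denom1 | rewrite /=; ring].
Qed.
Fact laddN : left_inverse l0 lopp ladd.
Proof.
move=> u; rewrite -(lreprK u) loppE laddE.
by apply/lpiP; exists 1; [exact: denom1 | rewrite /=; ring].
Qed.
HB.instance Definition _ := GRing.isZmodule.Build Loc laddA laddC ladd0 laddN.

Fact lmulA : associative lmul.
Proof.
move=> u v w; rewrite -(lreprK u) -(lreprK v) -(lreprK w) !lmulE.
by apply/lpiP; exists 1; [exact: denom1 | rewrite /=; ring].
Qed.
Fact lmulC : commutative lmul.
Proof.
move=> u v; rewrite -(lreprK u) -(lreprK v) !lmulE.
by apply/lpiP; exists 1; [exact: denom1 | rewrite /=; ring].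
Qed.
Fact lmul1 : left_id l1 lmul.
Proof.
move=> u; rewrite -(lreprK u) lmulE.
by apply/lpiP; exists 1; [exact: denom1 | rewrite /=; ring].
Qed.
Fact lmulDl : left_distributive lmul ladd.
Proof.
move=> u v w; rewrite -(lreprK u) -(lreprK v) -(lreprK w).
rewrite laddE !lmulE laddE.
by apply/lpiP; exists 1; [exact: denom1 | rewrite /=; ring].
Qed.
HB.instance Definition _ :=
  GRing.Zmodule_isComPzRing.Build Loc lmulA lmulC lmul1 lmulDl.

(* The fraction [a / s]; the value [a / 1] when [s] is not an admissible
   denominator is irrelevant. *)
Definition frac (a s : A) : Loc := lpi (a, insubd den1 s).

End Localization.

(** [ulim] below is the reduced product along any filter [U]; it is the
    ultraproduct when [U] is an ultrafilter. *)

Section Product.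
Variables (I : Type) (A : I -> comPzRingType).

Definition Prod : Type := forall i, A i.
HB.instance Definition _ := gen_eqMixin Prod.
HB.instance Definition _ := gen_choiceMixin Prod.

Definition prod0 : Prod := fun=> 0.
Definition prod1 : Prod := fun=> 1.
Definition prod_opp (x : Prod) : Prod := fun i => - x i.
Definition prod_add (x y : Prod) : Prod := fun i => x i + y i.
Definition prod_mul (x y : Prod) : Prod := fun i => x i * y i.

Fact prod_addA : associative prod_add.
Proof. by move=> x y z; apply: functional_extensionality_dep => i; apply: addrA. Qed.
Fact prod_addC : commutative prod_add.
Proof. by move=> x y; apply: functional_extensionality_dep => i; apply: addrC. Qed.
Fact prod_add0 : left_id prod0 prod_add.
Proof. by move=> x; apply: functional_extensionality_dep => i; apply: add0r. Qed.
Fact prod_addN : left_inverse prod0 prod_opp prod_add.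
Proof. by move=> x; apply: functional_extensionality_dep => i; apply: addNr. Qed.
HB.instance Definition _ :=
  GRing.isZmodule.Build Prod prod_addA prod_addC prod_add0 prod_addN.

Fact prod_mulA : associative prod_mul.
Proof. by move=> x y z; apply: functional_extensionality_dep => i; apply: mulrA. Qed.
Fact prod_mulC : commutative prod_mul.
Proof. by move=> x y; apply: functional_extensionality_dep => i; apply: mulrC. Qed.
Fact prod_mul1 : left_id prod1 prod_mul.
Proof. by move=> x; apply: functional_extensionality_dep => i; apply: mul1r. Qed.
Fact prod_mulDl : left_distributive prod_mul prod_add.
Proof. by move=> x y z; apply: functional_extensionality_dep => i; apply: mulrDl. Qed.
HB.instance Definition _ :=
  GRing.Zmodule_isComPzRing.Build Prod prod_mulA prod_mulC prod_mul1 prod_mulDl.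

End Product.

Section Ultraproduct.
Variables (I : Type) (U : filter_on I).

Section Def.
Variable A : I -> comPzRingType.

Definition null : set (Prod A) := [set x | \forall i \near U, x i = 0].

Fact null0 : null 0.
Proof. by apply: filterS filterT. Qed.
Fact nullD x y : null x -> null y -> null (x + y).
Proof.
move=> Ux Uy; apply: filterS (filterI Ux Uy) => i [xi yi].
by rewrite /= -[(x + y) i]/(x i + y i) xi yi addr0.
Qed.
Fact nullM a x : null x -> null (a * x).
Proof.
move=> Ux; apply: filterS Ux => i xi.
by rewrite /= -[(a * x) i]/(a i * x i) xi mulr0.
Qed.

Definition null_ideal : ideal (Prod A) := Ideal null0 nullD nullM.

Definition ulim : comPzRingType := Quot null_ideal.

Definition ulim_of (x : forall i, A i) : ulim := qpi null_ideal x.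

Lemma ulim_ofP (x y : forall i, A i) :
  ulim_of x = ulim_of y <-> \forall i \near U, x i = y i.
Proof.
rewrite /ulim_of qpiP; split; apply: filterS => i.
- move=> xy0; apply/subr0_eq; exact: xy0.
- by move=> /= xy; rewrite /= -[LHS]/(x i - y i) xy subrr.
Qed.

End Def.

Definition ulim_map (A B : I -> comPzRingType) (f : forall i, A i -> B i)
  (u : ulim A) : ulim B := ulim_of (fun i => f i (qrepr u i)).

Lemma ulim_mapE (A B : I -> comPzRingType) (f : forall i, A i -> B i) x :
  ulim_map f (ulim_of x) = ulim_of (fun i => f i (x i)).
Proof.
apply/ulim_ofP; have /ulim_ofP := qreprK (ulim_of x).
by apply: filterS => i /= ->.
Qed.

End Ultraproduct.

Record alg_closure (F : fieldType) := AlgClosure {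
  ac_field :> closedFieldType;
  ac_emb : {rmorphism F -> ac_field};
  ac_alg : integralRange ac_emb }.

(** [A] itself, with the [idomainType] structure provided by [is_domain A]. *)
Definition dom (A : comPzRingType) (_ : is_domain A) : Type := A.

Section Dom.
Variables (A : comPzRingType) (H : is_domain A).
Local Notation dom := (dom H).

HB.instance Definition _ := GRing.ComPzRing.on dom.

Fact dom_nz : (1 : dom) != 0.
Proof. by case: H => /eqP. Qed.
HB.instance Definition _ := GRing.PzSemiRing_isNonZero.Build dom dom_nz.

Definition dom_unit : pred dom := fun x => `[< exists y, y * x = 1 >].
Definition dom_inv (x : dom) : dom :=
  match pselect (exists y, y * x = 1) with
  | left e => projT1 (cid e) | right _ => x end.

Fact dom_mulV : {in dom_unit, left_inverse 1 dom_inv *%R}.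
Proof.
move=> x /asboolP e; rewrite /dom_inv.
by case: pselect => // e'; case: (cid e').
Qed.
Fact dom_unitP x y : y * x = 1 -> x \in dom_unit.
Proof. by move=> e; apply/asboolP; exists y. Qed.
Fact dom_inv0 : {in [predC dom_unit], dom_inv =1 id}.
Proof. by move=> x /asboolP n; rewrite /dom_inv; case: pselect. Qed.
HB.instance Definition _ :=
  GRing.ComNzRing_hasMulInverse.Build dom dom_mulV dom_unitP dom_inv0.

Fact dom_integral (x y : dom) : x * y = 0 -> (x == 0) || (y == 0).
Proof. by case: H => _ /[apply] -[->|->]; rewrite eqxx ?orbT. Qed.
HB.instance Definition _ := GRing.ComUnitRing_isIntegral.Build dom dom_integral.

End Dom.

Section IntClosure.
Variables (A : idomainType) (K : alg_closure {fraction A}).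

Definition to_closure : A -> K :=
  (ac_emb K) \o (@tofrac A).
HB.instance Definition _ := GRing.RMorphism.on to_closure.

Definition int_pred : pred K := fun z => `[< integralOver to_closure z >].

Fact int_subring : subring_closed int_pred.
Proof.
split=> [|x y /asboolP ix /asboolP iy|x y /asboolP ix /asboolP iy];
  apply/asboolP.
- exact: integral1.
- exact: integral_sub.
- exact: integral_mul.
Qed.
HB.instance Definition _ := GRing.isSubringClosed.Build K int_pred int_subring.

Definition int_cl : Type := {z : K | int_pred z}.
HB.instance Definition _ := SubChoice.on int_cl.
HB.instance Definition _ := [SubChoice_isSubComNzRing of int_cl by <:].

Fact int_cl_id (a : A) : int_pred (to_closure a).
Proof. by apply/asboolP; apply: integral_id. Qed.

Definition to_int_cl (a : A) : int_cl := exist _ (to_closure a) (int_cl_id a).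

End IntClosure.

Definition zero_ring : Type := unit.
HB.instance Definition _ := Choice.on zero_ring.
Section ZeroRing.
Let u0 : zero_ring := tt.
Fact zr_A : associative (fun _ _ : zero_ring => u0). Proof. by []. Qed.
Fact zr_C : commutative (fun _ _ : zero_ring => u0). Proof. by []. Qed.
Fact zr_1 : left_id u0 (fun _ _ : zero_ring => u0). Proof. by case. Qed.
Fact zr_N : left_inverse u0 (fun=> u0) (fun _ _ : zero_ring => u0).
Proof. by []. Qed.
HB.instance Definition _ := GRing.isZmodule.Build zero_ring zr_A zr_C zr_1 zr_N.
Fact zr_D : left_distributive (fun _ _ : zero_ring => u0) +%R.
Proof. by []. Qed.
HB.instance Definition _ :=
  GRing.Zmodule_isComPzRing.Build zero_ring zr_A zr_C zr_1 zr_D.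
End ZeroRing.

(** [A^+], and [A -> A^+]; [A^+ = 0] when [A] is not a domain. *)
Section Plus.
Variables (A : comPzRingType).
Variable K : forall H : is_domain A, alg_closure {fraction dom H}.

Definition plus_of (b : {is_domain A} + {~ is_domain A}) : comPzRingType :=
  match b with left H => int_cl (K H) | right _ => zero_ring end.
Definition to_plus_of b : A -> plus_of b :=
  match b return A -> plus_of b with
  | left H => fun a => to_int_cl (K H) (a : dom H)
  | right _ => fun=> tt end.

Definition plus : comPzRingType := plus_of (pselect (is_domain A)).
Definition to_plus : A -> plus := @to_plus_of (pselect (is_domain A)).

End Plus.

(** [(k[X] / (g))_p], with [p] the ideal of [k[X] / (g)] generated by the
    classes of [h]. *)
Section LocalAffine.
Variables (k : fieldType) (m rg rh : nat).
Variables (g : 'I_rg -> {mpoly k[m]}) (h : 'I_rh -> {mpoly k[m]}).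

Definition aff_ideal : ideal {mpoly k[m]} := ideal_gen (range g).
Definition aff : comPzRingType := Quot aff_ideal.
Definition aff_of : {mpoly k[m]} -> aff := qpi aff_ideal.
Definition aff_prime : ideal aff := ideal_gen (range (aff_of \o h)).
Definition loc_aff : comPzRingType := Loc aff_prime.
Definition loc_frac (a s : {mpoly k[m]}) : loc_aff :=
  frac aff_prime (aff_of a) (aff_of s).

End LocalAffine.

Definition Primes := {p : nat | prime p}.

Section Approximation.
Variables (C : fieldType) (U : filter_on Primes).
Variable F : forall p : Primes, alg_closure 'F_(val p).
Variable theta : C -> ulim U (fun p => F p).

Definition approx (c : C) (c_ : forall p, F p) : Prop :=
  theta c = ulim_of U (A := fun p => F p) c_.

Definition approx_mpoly m (f : {mpoly C[m]}) (f_ : forall p, {mpoly (F p)[m]}) :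
  Prop :=
  exists c : 'X_{1..m} -> forall p, F p,
    (forall mu, mu \in msupp f -> approx f@_mu (c mu)) /\
    (forall p, f_ p = \sum_(mu <- msupp f) c mu p *: 'X_[mu]).

(* A ring [R] presented as a local affine algebra by [e]. *)
Variables (m rg rh : nat).
Variables (g : 'I_rg -> {mpoly C[m]}) (h : 'I_rh -> {mpoly C[m]}).
Variables (g_ : forall p, 'I_rg -> {mpoly (F p)[m]}).
Variables (h_ : forall p, 'I_rh -> {mpoly (F p)[m]}).
Variables (R : comPzRingType) (e : loc_aff g h -> R).

Definition approx_ring (p : Primes) : comPzRingType := loc_aff (g_ p) (h_ p).

Definition approx_elem (r : R) (r_ : forall p, approx_ring p) : Prop :=
  exists a s a_ s_,
    [/\ approx_mpoly a a_, approx_mpoly s s_,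
        ~ aff_prime g h (aff_of g s), e (loc_frac g h a s) = r &
        forall p, r_ p = loc_frac (g_ p) (h_ p) (a_ p) (s_ p)].

Definition hull : comPzRingType := ulim U approx_ring.

(* All approximations of [r] have the same ultraproduct, so the choice made by
   [xget] is immaterial. *)
Definition to_hull (r : R) : hull :=
  xget 0 [set ulim_of U r_ | r_ in approx_elem r].

Variable K : forall p (H : is_domain (approx_ring p)),
  alg_closure {fraction dom H}.

Definition BB : comPzRingType := ulim U (fun p => plus (@K p)).
Definition to_BB (r : R) : BB :=
  ulim_map (fun p => @to_plus _ (@K p)) (to_hull r).

End Approximation.

(* Main.v *)
(** In characteristic [p] let [z] be integral over [I^(n+k)], [I = (g_1, ..., g_n)],
    with an equation of degree [d], and consider the fractions [e = z^i g^(-al)]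
    with [i <= d] and [|al| = n i].  Reducing [z^(p i)] modulo the equation writes
    [e^p] as a linear combination of such fractions, plus one error term [u_l]
    for each [l], whose denominator does not involve [g_l].  Over an algebraically
    closed field the systems [y_l^p = A y_l + u_l] are solvable, so that
    [e = w + sum_l y_l] with [w^p = A w].  These equations force [w] to be integral,
    and [y_l] to be integral up to a denominator free of [g_l].  For
    [z / (g_1 ... g_n)] this says [z = sum_l g_l eta_l] with [eta_l] integral over
    [I^(n+k-1)], and iterating gives [z] in [I^(k+1) R^+].

    An integral equation over [R] transfers to almost all [R_p] as soon as
    [R -> R_infty] is a well defined ring homomorphism.  For this it suffices that
    an element outside the prime [(g, h)] has approximations outside
    [(g_p, h_p)], which follows by approximating a point, provided by the
    Nullstellensatz, where [g] and [h] vanish and the element does not. *)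

Require Import Defs.
From HB Require Import structures.
From mathcomp Require Import all_boot all_order all_algebra.
From mathcomp Require Import generic_quotient fraction complex mpoly.
From mathcomp Require Import boolp classical_sets filter reals.
From mathcomp Require Import ring zify.

Set Implicit Arguments.
Unset Strict Implicit.
Unset Printing Implicit Defensive.

Import Order.TTheory GRing.Theory Num.Theory.
Local Open Scope classical_set_scope.
Local Open Scope ring_scope.

(** * Frobenius-linear systems *)

Section FrobeniusSystem.
Variables (K : closedFieldType) (p : nat) (charKp : p \in [pchar K]).

Let p_prime : prime p := pcharf_prime charKp.
Let p_gt0 : (0 < p)%N := prime_gt0 p_prime.

Lemma pchar_sum_expr (J : finType) (F : J -> K) e :
  (\sum_j F j) ^+ (p ^ e) = \sum_j F j ^+ (p ^ e).
Proof.
elim: e => [|e IH]; first by rewrite expn0 expr1.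
rewrite expnSr exprM IH -(pFrobenius_autE charKp) rmorph_sum /=.
by apply: eq_bigr => j _; rewrite pFrobenius_autE -exprM.
Qed.

Lemma pchar_exprD (x y : K) e :
  (x + y) ^+ (p ^ e) = x ^+ (p ^ e) + y ^+ (p ^ e).
Proof.
by have := pchar_sum_expr (fun b : bool => if b then x else y) e; rewrite !big_bool.
Qed.

Lemma pchar_exprB (x y : K) e :
  (x - y) ^+ (p ^ e) = x ^+ (p ^ e) - y ^+ (p ^ e).
Proof. by apply/eqP; rewrite eq_sym subr_eq -pchar_exprD subrK. Qed.

Lemma pchar_expr_inj e : injective (fun x : K => x ^+ (p ^ e)).
Proof.
move=> x y /= exy; apply/eqP; rewrite -subr_eq0.
have : (x - y) ^+ (p ^ e) == 0 by rewrite pchar_exprB exy subrr.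
by rewrite expf_eq0 => /andP[].
Qed.

Lemma proot_exists (x : K) : exists y, y ^+ p = x.
Proof.
have [y] := @solve_monicpoly K p (fun i => if i == 0%N then x else 0) p_gt0.
rewrite (bigD1 (Ordinal p_gt0)) //= expr0 mulr1 big1 ?addr0 => [<-|i]; first by exists y.
by rewrite -val_eqE /= => /negPf->; rewrite mul0r.
Qed.

Let proot x := projT1 (cid (proot_exists x)).
Let prootK x : proot x ^+ p = x.
Proof. exact: (projT2 (cid (proot_exists x))). Qed.

(** The right side has degree below [p ^ m] in [s], so subtracting it from ['X^(p ^ m)] leaves a
    nonconstant polynomial over an algebraically closed field. *)
Lemma additive_poly_root (m : nat) (c : nat -> K) :
  exists s : K, s ^+ (p ^ m) = 1 + \sum_(l < m) c l * s ^+ (p ^ l).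
Proof.
pose r : {poly K} := 1 + \sum_(l < m) c l *: 'X^(p ^ l).
have sr : (size r <= p ^ m)%N.
  apply: leq_trans (size_polyD _ _) _; rewrite size_poly1 geq_max expn_gt0 p_gt0 /=.
  apply: (leq_trans (size_sum _ _ _)); apply/bigmax_leqP => l _.
  apply: leq_trans (size_scale_leq _ _) _; rewrite size_polyXn.
  by rewrite ltn_exp2l ?prime_gt1.
have /closed_rootP[s] : size ('X^(p ^ m) - r) != 1%N.
  rewrite size_polyDl ?size_polyXn ?size_polyN ?ltnS //.
  by rewrite eqSS expn_eq0 negb_and -lt0n p_gt0.
rewrite rootE hornerD hornerN hornerD hornerC hornerXn horner_sum subr_eq0 => /eqP e; exists s.
rewrite {1}e; congr (_ + _); apply: eq_bigr => l _.
by rewrite hornerZ hornerXn.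
Qed.

(** Otherwise every [w m] would raise the rank of the span of its predecessors, and after [#|J|.+1]
    vectors the rank would exceed the dimension [#|J|]. *)
Lemma first_dependency (J : finType) (v : nat -> J -> K) :
  exists (m : nat) (c : nat -> K), forall j, v m j = \sum_(i < m) c i * v i j.
Proof.
pose w i : 'rV[K]_#|J| := \row_k v i (enum_val k).
have [[m]|nex] := pselect (exists m, (w m <= \sum_(i < m) <<w i>>)%MS).
  case/sub_sumsmxP => u e.
  have /choice[c ec] (i : 'I_m) : exists a, u i *m <<w i>>%MS = a *: w i.
    by apply/sub_rVP; rewrite -(genmxE (w i)) submxMl.
  exists m, (fun i => oapp c 0 (insub i)) => j.
  move/rowP: e => /(_ (enum_rank j)); rewrite mxE enum_rankK => ->.
  by rewrite summxE; apply: eq_bigr => i _; rewrite ec !mxE enum_rankK valK.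
have rk m : (m <= \rank (\sum_(i < m) <<w i>>)%MS)%N.
  elim: m => [|m IH] //; apply: leq_ltn_trans IH _; apply: rank_ltmx.
  rewrite big_ord_recr /= /ltmx addsmxSl /=; apply/negP => h.
  by apply: nex; exists m; rewrite -genmxE; apply: submx_trans h; apply: addsmxSr.
by have := leq_trans (rk #|J|.+1) (rank_leq_row _); rewrite ltnn.
Qed.

(* With [a 0 = u], [v i = a i ^ (1/p)] and [a i.+1 = A (v i)], the first relation
   [v m = sum_(i < m) c i v i] turns the system for [y = sum_(i < m) x i.+1 v i]
   into [x i.+1 ^ p = x i + c i ^ p x m] with [x 0 = 1]: one additive polynomial
   equation for [x m]. *)
Lemma frobenius_system_solvable (J : finType) (A : J -> J -> K) (u : J -> K) :
  exists y : J -> K, forall j, y j ^+ p = \sum_i A j i * y i + u j.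
Proof.
pose v := fix v i : J -> K := if i is i'.+1
  then fun j => proot (\sum_l A j l * v i' l) else fun j => proot (u j).
have [m [c vm]] := first_dependency v.
have [s es] := additive_poly_root m (fun l => c l ^+ (p ^ l.+1)).
pose x := fix x i := if i is i'.+1 then proot (x i' + s * c i' ^+ p) else 1.
have ex i : x i ^+ (p ^ i) = 1 + \sum_(l < i) c l ^+ (p ^ l.+1) * s ^+ (p ^ l).
  elim: i => [|i IH]; first by rewrite big_ord0 addr0 expr1n.
  rewrite expnS exprM /= prootK pchar_exprD IH big_ord_recr /= addrA.
  by rewrite exprMn -exprM -expnS [_ * c i ^+ _]mulrC.
(* The sequence [x] is built with [s] as a guess for its own entry [x m]; [es] makes the guess
   consistent, since [p ^ m]-th roots are unique in characteristic [p]. *)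
have xm : x m = s by apply: (@pchar_expr_inj m); rewrite /= ex es.
exists (fun j => \sum_(i < m) x i.+1 * v i j) => j.
have := pchar_sum_expr (fun i : 'I_m => x i.+1 * v i j) 1; rewrite expn1 => ->.

have vS i : v i.+1 j ^+ p = \sum_l A j l * v i l by rewrite /= prootK.
have v0 : v 0%N j ^+ p = u j by rewrite /= prootK.
have -> : \sum_l A j l * (\sum_(i < m) x i.+1 * v i l) =
          \sum_(i < m) x i.+1 * v i.+1 j ^+ p.
  under eq_bigr do rewrite mulr_sumr.
  rewrite exchange_big /=; apply: eq_bigr => i _; rewrite -/(v i.+1) vS mulr_sumr.
  by apply: eq_bigr => l _; rewrite mulrCA.
have -> : \sum_(i < m) x i.+1 * v i.+1 j ^+ p + u j =
          \sum_(i < m.+1) x i * v i j ^+ p.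
  by rewrite big_ord_recl /= mul1r prootK addrC.
rewrite big_ord_recr /= xm.
have := pchar_sum_expr (fun i : 'I_m => c i * v i j) 1; rewrite expn1 -vm => ->.
rewrite mulr_sumr -big_split /=; apply: eq_bigr => i _.
by rewrite !exprMn prootK mulrDl mulrA.
Qed.

End FrobeniusSystem.

(** * Integrality *)

Section Integrality.
Variables (B : comNzRingType) (L : fieldType) (phi : {rmorphism B -> L}).
Local Notation Int := (integralOver phi).

Definition integral_pred : {pred L} := fun x => `[< Int x >].

Fact integral_pred_subring : subring_closed integral_pred.
Proof.
split=> [|x y /asboolP ix /asboolP iy|x y /asboolP ix /asboolP iy];
  apply/asboolP.
- exact: integral1.
- exact: integral_sub.
- exact: integral_mul.
Qed.
HB.instance Definition _ := GRing.isSubringClosed.Build L integral_pred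
  integral_pred_subring.

Lemma integralP x : reflect (Int x) (x \in integral_pred).
Proof. exact: asboolP. Qed.

Lemma integral_exp x e : Int x -> Int (x ^+ e).
Proof. by move=> /integralP ix; apply/integralP; rewrite rpredX. Qed.

Lemma integral_prod (J : finType) (P : pred J) (F : J -> L) :
  (forall j, P j -> Int (F j)) -> Int (\prod_(j | P j) F j).
Proof. by move=> iF; apply/integralP/rpred_prod => j /iF/integralP. Qed.

Lemma integral_equation d (c : nat -> L) x :
    (forall i, (1 <= i <= d)%N -> Int (c i)) ->
    x ^+ d = \sum_(1 <= i < d.+1) c i * x ^+ (d - i) -> Int x.
Proof.
move=> ic ex; pose q := \sum_(1 <= i < d.+1) c i *: 'X^(d - i) : {poly L}.
have sq : (size q <= d)%N.
  rewrite /q big_nat; apply: (big_ind (fun r : {poly L} => size r <= d)%N).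
  - by rewrite size_poly0.
  - by move=> u v su sv; rewrite (leq_trans (size_polyD _ _)) // geq_max su.
  - move=> i /andP[i0 id]; apply: leq_trans (size_scale_leq _ _) _.
    by rewrite size_polyXn ltn_subrL i0 (leq_trans i0).
apply: (@integral_root_monic _ _ _ _ ('X^d - q)).
- rewrite monicE lead_coefDl ?lead_coefXn // size_polyN size_polyXn ltnS //.
- rewrite rootE hornerD hornerN hornerXn /q horner_sum subr_eq0 ex; apply/eqP.
  by apply: eq_bigr => i _; rewrite hornerZ hornerXn.
- apply/integral_poly => j; rewrite coefB coefXn /q coef_sum.
  apply: integral_sub; first exact: integral_nat.
  apply/integralP; rewrite big_nat; apply: rpred_sum => i id.
  rewrite coefZ coefXn; apply: rpredM; last exact: rpred_nat.
  by apply/integralP/ic.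
Qed.

(** The determinant trick: [x] is an eigenvalue of the transpose [N] of [M], whose characteristic
    polynomial is monic with integral coefficients. *)
Lemma integral_eigen (T : finType) (w : T -> L) (x : L) (M : T -> T -> L) t0 :
    w t0 != 0 -> (forall s t, Int (M s t)) ->
  (forall s, x * w s = \sum_t M s t * w t) -> Int x.
Proof.
move=> w0 iM xw.
pose N := \matrix_(i < #|T|, j < #|T|) M (enum_val j) (enum_val i).
pose v := \row_(i < #|T|) w (enum_val i).
apply: (integral_root_monic (char_poly_monic N)).
  rewrite -eigenvalue_root_char; apply/eigenvalueP; exists v.
    apply/rowP => i; rewrite !mxE xw.
    rewrite [RHS](reindex_onto enum_val enum_rank) /=; last by move=> ? _; rewrite enum_rankK.
    apply: eq_big => [k|k _]; first by rewrite enum_valK eqxx.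
    by rewrite !mxE mulrC.
  by apply: contra w0 => /eqP/rowP/(_ (enum_rank t0)); rewrite !mxE enum_rankK => ->.
suff /polyOverP ip : char_poly N \is a polyOver integral_pred.
  by apply/integral_poly => i; apply/integralP/ip.
rewrite /char_poly /determinant; apply: rpred_sum => s _.
apply: rpredM; first by rewrite rpredX // rpredN rpred1.
apply: rpred_prod => i _; rewrite !mxE; apply: rpredB.
  by rewrite rpredMn // polyOverX.
by rewrite polyOverC; apply/integralP.
Qed.

(* The monomials in the [V j] with exponents below [p] span a ring that is a
   finite module. *)
Lemma frobenius_system_integral p (J : finType) (V U : J -> L)
    (A : J -> J -> L) :
    (1 < p)%N -> (forall j l, Int (A j l)) -> (forall j, Int (U j)) ->
    (forall j, V j ^+ p = \sum_l A j l * V l + U j) ->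
  forall j, Int (V j).
Proof.
move=> p_gt1 iA iU eV j0; have p_gt0 := ltnW p_gt1.
pose T := {ffun J -> 'I_p}.
pose w (b : T) := \prod_j V j ^+ b j.
pose sp x := exists c : T -> L, (forall t, Int (c t)) /\ x = \sum_t c t * w t.
have spD x y : sp x -> sp y -> sp (x + y).
  move=> [c [ic ->]] [d [id ->]]; exists (fun t => c t + d t); split.
    by move=> t; apply: integral_add.
  by rewrite -big_split; apply: eq_bigr => t _; rewrite mulrDl.
have spZ a x : Int a -> sp x -> sp (a * x).
  move=> ia [c [ic ->]]; exists (fun t => a * c t); split.
    by move=> t; apply: integral_mul.
  by rewrite mulr_sumr; apply: eq_bigr => t _; rewrite mulrA.
have sp0 : sp 0.
  exists (fun=> 0); split=> [t|]; first exact: integral0.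
  by rewrite big1 // => t _; rewrite mul0r.
(* Induction on a bound for the total degree: replacing a factor [V j ^+ p] by means of [eV] lowers
   the degree, because [p > 1]. *)
have spm (n : nat) (g : {ffun J -> nat}) :
    (\sum_j g j <= n)%N -> sp (\prod_j V j ^+ g j).
  elim: n g => [|n IH] g; last first.
    have [/forallP gp|] := boolP [forall j, (g j < p)%N].
      move=> _; exists (fun t => (t == [ffun j => Ordinal (gp j)])%:R).
      split=> [t|]; first exact: integral_nat.
      rewrite (bigD1 [ffun j => Ordinal (gp j)]) //= eqxx mul1r [X in _ + X]big1 ?addr0.
        by rewrite /w; apply: eq_bigr => j _; rewrite ffunE.
      by move=> t /negPf->; rewrite mul0r.
    rewrite negb_forall => /existsP[j]; rewrite -leqNgt => pj gn.
    pose g' := [ffun l => if l == j then (g j - p)%N else g l].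
    have -> : \prod_l V l ^+ g l = V j ^+ p * \prod_l V l ^+ g' l.
      rewrite (bigD1 j) //= [in RHS](bigD1 j) //= ffunE eqxx mulrA -exprD subnKC //.
      by congr (_ * _); apply: eq_bigr => l /negPf lj; rewrite ffunE lj.
    have sg : (\sum_l g l = p + \sum_l g' l)%N.
      rewrite (bigD1 j) //= [in RHS](bigD1 j) //= ffunE eqxx addnA subnKC //.
      by congr (_ + _)%N; apply: eq_bigr => l /negPf lj; rewrite ffunE lj.
    rewrite eV mulrDl; apply: (spD _ _); last first.
      apply: spZ => //; apply: IH; rewrite -ltnS; apply: leq_trans gn.
      by rewrite sg -addn1 addnC leq_add2r ltnW.
    rewrite mulr_suml; apply: (big_ind sp sp0 spD) => l _; rewrite -mulrA; apply: spZ => //.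
    pose g'' := [ffun i => ((i == l) + g' i)%N].
    have -> : V l * \prod_i V i ^+ g' i = \prod_i V i ^+ g'' i.
      rewrite (bigD1 l) //= [in RHS](bigD1 l) //= [g'' l]ffunE eqxx exprS mulrA.
      by congr (_ * _); apply: eq_bigr => i /negPf il; rewrite [g'' i]ffunE il.
    apply: IH; rewrite -ltnS; apply: leq_trans gn; rewrite sg.
    under eq_bigr do rewrite ffunE.
    rewrite big_split /= (bigD1 l) //= eqxx big1 ?addn0; last by move=> i /negPf->.
    by rewrite -addSn leq_add2r.
  rewrite leqn0 sum_nat_eq0 => /forallP g0.
  rewrite big1 => [|j _]; last by rewrite (eqP (g0 j)).
  exists (fun t => (t == [ffun=> Ordinal p_gt0])%:R).
  split=> [t|]; first exact: integral_nat.
  rewrite (bigD1 [ffun=> Ordinal p_gt0]) //= eqxx mul1r big1 ?addr0.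
    by rewrite /w big1 // => j _; rewrite ffunE.
  by move=> t /negPf->; rewrite mul0r.
have /choice[M HM] (s : T) : sp (V j0 * w s).
  pose g := [ffun i => ((i == j0) + s i)%N].
  have -> : V j0 * w s = \prod_i V i ^+ g i.
    rewrite /w (bigD1 j0) //= [in RHS](bigD1 j0) //= [g j0]ffunE eqxx exprS mulrA.
    by congr (_ * _); apply: eq_bigr => i /negPf il; rewrite [g i]ffunE il.
  exact: (spm _ _ (leqnn _)).
apply: (@integral_eigen T w (V j0) M [ffun=> Ordinal p_gt0]).
- by rewrite /w big1 ?oner_eq0 // => j _; rewrite ffunE.
- by move=> s t; case: (HM s).
- by move=> s; case: (HM s).
Qed.

End Integrality.

(** * Division by the generators *)

(** Finite sums of elements of [G]. The inductive form lets expansions with an unspecified number of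
    terms be treated one term at a time. *)
Inductive addcl (V : zmodType) (G : V -> Prop) : V -> Prop :=
| addcl0 : addcl G 0
| addclD x y of G x & addcl G y : addcl G (x + y).

Section AdditiveClosure.
Variables (V : zmodType) (G : V -> Prop).

Lemma addcl_gen x : G x -> addcl G x.
Proof. by move=> Gx; rewrite -[x]addr0; apply: addclD => //; apply: addcl0. Qed.

Lemma addcl_add x y : addcl G x -> addcl G y -> addcl G (x + y).
Proof.
move=> Gx Gy; elim: Gx => [|u v Gu _ IH]; first by rewrite add0r.
by rewrite -addrA; apply: addclD.
Qed.

Lemma addcl_sum (J : Type) (r : seq J) (P : pred J) (F : J -> V) :
  (forall j, P j -> addcl G (F j)) -> addcl G (\sum_(j <- r | P j) F j).
Proof. by move=> GF; apply: (big_ind (addcl G) (addcl0 G) addcl_add). Qed.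

End AdditiveClosure.

Lemma addcl_map (V V' : zmodType) (G : V -> Prop) (f : V -> V') (G' : V' -> Prop) x :
    f 0 = 0 -> {morph f : u v / u + v} ->
    (forall y, G y -> addcl G' (f y)) ->
  addcl G x -> addcl G' (f x).
Proof.
move=> f0 fD GG'; elim=> [|u v Gu _ IH]; first by rewrite f0; apply: addcl0.
by rewrite fD; apply: addcl_add => //; apply: GG'.
Qed.

Lemma addcl_mul (A : comPzRingType) (G G' H : A -> Prop) x y :
  (forall u v, G u -> G' v -> H (u * v)) ->
  addcl G x -> addcl G' y -> addcl H (x * y).
Proof.
move=> GH Gx Gy; apply: addcl_map Gy => [|u v|v Gv]; rewrite ?mulr0 ?mulrDr //.
apply: (addcl_map (f := *%R^~ v)) Gx => [|u w|u Gu]; rewrite ?mul0r ?mulrDl //.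
by apply: addcl_gen; apply: GH.
Qed.

Lemma expfB_leq (F : fieldType) (x : F) m n :
  x != 0 -> (n <= m)%N -> x ^+ (m - n) = x ^+ m / x ^+ n.
Proof. by move=> /negPf x0 nm; rewrite expfB_cond // x0. Qed.

Section Division.
Variables (K : closedFieldType) (p : nat) (charKp : p \in [pchar K]).
Variables (B : comNzRingType) (L : fieldType) (phi : {rmorphism B -> L}).
Variables (iota : {rmorphism K -> L}) (tau : L) (tau_neq0 : tau != 0).
Local Notation Int := (integralOver phi).

(* For [phi] the inclusion of a Rees algebra [S[It]] in [K(t)] and [tau = t] this
   is the integral closure of [I^D] in [K]. *)
Definition wt D x := Int (iota x * tau ^+ D).

Lemma wtM D D' x y : wt D x -> wt D' y -> wt (D + D') (x * y).
Proof. by rewrite /wt rmorphM exprD mulrACA; apply: integral_mul. Qed.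

Let p_gt1 : (1 < p)%N := prime_gt1 (pcharf_prime charKp).

(** The products [iota (y j) * G j] satisfy a Frobenius-linear system whose coefficients are the
    scaled ones, hence integral. *)
Lemma scaled_system_integral (E : finType) (A : E -> E -> K) (u y : E -> K)
    (G : E -> L) :
    (forall j, G j != 0) ->
    (forall j, y j ^+ p = \sum_m A j m * y m + u j) ->
    (forall j m, Int (iota (A j m) * G j ^+ p / G m)) ->
    (forall j, Int (iota (u j) * G j ^+ p)) ->
  forall j, Int (iota (y j) * G j).
Proof.
move=> G0 ey iA iu.
apply: (frobenius_system_integral p_gt1 iA iu) => j.
rewrite exprMn -rmorphXn ey rmorphD rmorph_sum mulrDl mulr_suml; congr (_ + _).
apply: eq_bigr => m _; rewrite rmorphM /=.
by field; apply: G0.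
Qed.

Variables (J : finType) (g : J -> K) (g_neq0 : forall l, g l != 0).
Hypothesis g_wt : forall l, wt 1 (g l).
Local Notation N := #|J|.
Local Notation "'mon' mu" := (\prod_l g l ^+ mu l) (at level 10, mu at level 9).

Variables (k d : nat) (z : K) (a : nat -> K).

(** Models a term of an element of [I^((N + k) s)], with [I] generated by the [g l]: [N * s] factors
    are kept as an explicit monomial, the other [k * s] only through the weight of [rho]. *)
Definition coef_term s x := exists rho (mu : J -> nat),
  [/\ x = rho * mon mu, (\sum_l mu l = N * s)%N & wt (k * s) rho].

(** The shape of the terms once the exponent of [z] has been brought from [n] down to some [i <= d]:
    the drop is paid for by [N * (n - i)] factors [g l] and by weight [k * (n - i)]. *)
Definition power_term n x := exists rho (mu : J -> nat) i,
  [/\ x = rho * mon mu * z ^+ i, (i <= d)%N, (i <= n)%N,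
      (\sum_l mu l = N * (n - i))%N & wt (k * (n - i)) rho].

Hypothesis d_gt0 : (0 < d)%N.
Hypothesis z_wt : wt (N + k) z.
Hypothesis z_eq : z ^+ d = \sum_(1 <= i < d.+1) a i * z ^+ (d - i).
Hypothesis a_coef : forall i, (1 <= i <= d)%N -> addcl (coef_term i) (a i).

Lemma power_reduction n : addcl (power_term n) (z ^+ n).
Proof.
elim/ltn_ind: n => n IH; have [nd|dn] := leqP n d.
  apply: addcl_gen; exists 1, (fun=> 0%N), n; split=> //.
  - by rewrite big1 ?mul1r // => l _; rewrite expr0.
  - by rewrite subnn muln0 big1.
  - by rewrite subnn muln0 /wt rmorph1 mulr1; apply: integral1.
have -> : z ^+ n = \sum_(1 <= i < d.+1) a i * z ^+ (n - i).
  rewrite -(subnKC (ltnW dn)) exprD z_eq mulr_suml !big_nat.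
  apply: eq_bigr => i /andP[_ id]; rewrite -mulrA -exprD subnKC ?(ltnW dn) //.
  by congr (_ * _ ^+ _); rewrite addnC addnBA // subnK // ltnW.
rewrite big_nat; apply: addcl_sum => i /andP[i0 id].
have ltin : (i < n)%N by apply: leq_ltn_trans dn.
apply: addcl_mul (a_coef _) (IH (n - i)%N _); rewrite ?i0 //; last first.
  by rewrite ltn_subrL i0 (leq_ltn_trans _ ltin).
move=> x y [r [mu [-> smu wr]]] [r' [mu' [i' [-> i'd i'n smu' wr']]]].
have e : (n - i' = i + (n - i - i'))%N by lia.
exists (r * r'), (fun l => mu l + mu' l)%N, i'; split=> //.
- under [X in _ = _ * X * _]eq_bigr do rewrite exprD.
  by rewrite big_split /=; ring.
- by apply: leq_trans i'n _; apply: leq_subr.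
- by rewrite big_split /= smu smu' -mulnDr e.
- by rewrite e mulnDr; apply: wtM.
Qed.

Section Induction.
Variables (E : finType) (al : E -> J -> nat) (ii : E -> nat).
Hypothesis al_sum : forall m, (\sum_l al m l = N * ii m)%N.
Hypothesis E_full : forall (mu : J -> nat) i, (i <= d)%N ->
  (\sum_l mu l = N * i)%N ->
  exists m, al m =1 mu /\ ii m = i.

Let e m : K := z ^+ ii m / mon (al m).
Let g' l := iota (g l) * tau.
(* Scaling by [G l] clears the denominators except at [g l]. *)
Let G0 m := tau ^+ (k * ii m).
Let G l m := G0 m * \prod_(x | x != l) g' x ^+ al m x.

(** One matrix serves for [w] and for all the [y_l], so its entries must become integral under the
    scaling [G0] as well as under every [G l]. *)
Definition matrix_coef j m (b : K) : Prop :=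
  Int (iota b * G0 j ^+ p / G0 m) /\
  forall l, Int (iota b * G l j ^+ p / G l m).

(** The form wanted for [e j ^+ p]: row [j] of the matrix plus one error term per generator, with
    the integrality that [scaled_system_integral] requires. *)
Definition frobenius_span j x : Prop := exists (A : E -> K) (u : J -> K),
  [/\ x = \sum_m A m * e m + \sum_l u l, forall m, matrix_coef j m (A m) &
      forall l, Int (iota (u l) * G l j ^+ p)].

Let mon_neq0 mu : mon mu != 0.
Proof. by apply/prodf_neq0 => l _; rewrite expf_neq0. Qed.
Let g'_neq0 l : g' l != 0.
Proof. by rewrite mulf_neq0 // fmorph_eq0. Qed.
Let G0_neq0 m : G0 m != 0.
Proof. by rewrite expf_neq0. Qed.
Let G_neq0 l m : G l m != 0.
Proof. by rewrite mulf_neq0 //; apply/prodf_neq0 => x _; rewrite expf_neq0. Qed.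
Let g'_int l : Int (g' l).
Proof. by have := g_wt l; rewrite /wt expr1. Qed.

Lemma frobenius_span0 j : frobenius_span j 0.
Proof.
exists (fun=> 0), (fun=> 0); split=> [|m|l].
- by rewrite !big1 ?addr0 // => l _; rewrite mul0r.
- by split=> [|l]; rewrite rmorph0 !mul0r; apply: integral0.
- by rewrite rmorph0 mul0r; apply: integral0.
Qed.

Lemma frobenius_spanD j x y :
  frobenius_span j x -> frobenius_span j y -> frobenius_span j (x + y).
Proof.
move=> [A [u [-> iA iu]]] [A' [u' [-> iA' iu']]].
exists (fun m => A m + A' m), (fun l => u l + u' l); split=> [|m|l].
- rewrite big_split /= addrACA -big_split; congr (_ + _).
  by apply: eq_bigr => m _; rewrite mulrDl.
- have [[h1 h2] [h1' h2']] := (iA m, iA' m).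
  by split=> [|l]; rewrite rmorphD !mulrDl; apply: integral_add.
- by rewrite rmorphD mulrDl; apply: integral_add.
Qed.

(* If [mu <= p al] everywhere, the term is again a multiple of some [e m];
   otherwise it goes to the error term of an [l] with [mu l > p al l]. *)
Lemma frobenius_span_term j x :
  power_term (p * ii j) x -> frobenius_span j (x / mon (al j) ^+ p).
Proof.
move=> [r [mu [i [-> id ip smu wr]]]].
have [/forallP le_mu|] := boolP [forall l, mu l <= p * al j l]%N.
  have := E_full (mu := fun l => (p * al j l - mu l)%N) id.
  case=> [|m [alm iim]].
    rewrite sumnB; last by move=> l _; apply: le_mu.
    by rewrite -big_distrr /= al_sum smu mulnCA -mulnBr subKn.
  exists (fun m' => if m' == m then r else 0), (fun=> 0); split=> [|m'|l].
  - rewrite (bigD1 m) //= eqxx [X in _ + X + _]big1 => [|m' /negPf->]; last by rewrite mul0r.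
    rewrite [X in _ + X]big1 // !addr0.
    rewrite /e iim; have -> : mon (al m) = mon (al j) ^+ p / mon mu.
      rewrite -prodrXl -prodf_div; apply: eq_bigr => l _.
      by rewrite alm expfB_leq ?le_mu // -exprM mulnC.
    by field; rewrite !mon_neq0 expf_neq0.
  - have [->|_] := eqVneq; last first.
      by split=> [|l]; rewrite rmorph0 !mul0r; apply: integral0.
    have e0 : iota r * G0 j ^+ p / G0 m = iota r * tau ^+ (k * (p * ii j - i)).
      rewrite -mulrA /G0 iim; congr (_ * _); rewrite -exprM -expfB_leq //; last by nia.
      by congr (_ ^+ _); rewrite mulnBr; nia.
    split=> [|l]; first by rewrite e0.
    (* Here [al m = p al j - mu], so passing from [G0] to [G l] only multiplies by the integral
       monomial with exponents [mu x], [x != l]. *)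
    have -> : iota r * G l j ^+ p / G l m =
        iota r * G0 j ^+ p / G0 m * \prod_(x | x != l) g' x ^+ mu x.
      have -> : \prod_(x | x != l) g' x ^+ mu x =
          (\prod_(x | x != l) g' x ^+ al j x) ^+ p / \prod_(x | x != l) g' x ^+ al m x.
        rewrite -prodrXl -prodf_div; apply: eq_bigr => y _.
        by rewrite alm -exprM mulnC -expfB_leq ?leq_subr // subKn.
      rewrite /G exprMn.
      field; rewrite G0_neq0 andbT.
      by apply/prodf_neq0 => y _; rewrite expf_neq0.
    rewrite e0; apply: integral_mul => //.
    by apply: integral_prod => y _; apply: integral_exp.
  - by rewrite rmorph0 mul0r; apply: integral0.
rewrite negb_forall => /existsP[l]; rewrite -ltnNge => /ltnW le_mu.
exists (fun=> 0), (fun l' => if l' == l then r * mon mu * z ^+ i / mon (al j) ^+ p else 0).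
split=> [|m|l'].
- rewrite [X in _ = X + _]big1 ?add0r => [|m _]; last by rewrite mul0r.
  by rewrite [RHS](bigD1 l) //= eqxx [X in _ = _ + X]big1 ?addr0 // => l' /negPf->.
- by split=> [|y]; rewrite rmorph0 !mul0r; apply: integral0.
have [->|_] := eqVneq; last by rewrite rmorph0 !mul0r; apply: integral0.
(* The factor [G l j ^+ p] clears all generators other than [g l] from the denominator, and [g l]
   cancels because [mu l] exceeds [p * al j l]. What remains is a product of integral factors; their
   exponents of [tau] add up correctly by [et]. *)
suff -> : iota (r * mon mu * z ^+ i / mon (al j) ^+ p) * G l j ^+ p =
    iota r * tau ^+ (k * (p * ii j - i)) * (iota z * tau ^+ (N + k)) ^+ i *
    g' l ^+ (mu l - p * al j l) * \prod_(x | x != l) g' x ^+ mu x.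
  apply: integral_mul; last by apply: integral_prod => y _; apply: integral_exp.
  apply: integral_mul; last exact: integral_exp.
  by apply: integral_mul => //; apply: integral_exp.
have split_mon nu : iota (mon nu) =
    iota (g l) ^+ nu l * \prod_(y | y != l) iota (g y) ^+ nu y.
  rewrite (bigD1 l) //= rmorphM rmorph_prod rmorphXn; congr (_ * _).
  by apply: eq_bigr => y _; rewrite rmorphXn.
have split_g' (nu : J -> nat) : \prod_(y | y != l) g' y ^+ nu y =
    \prod_(y | y != l) iota (g y) ^+ nu y * tau ^+ (\sum_(y | y != l) nu y).
  by rewrite -prodrXr -big_split; apply: eq_bigr => y _; rewrite exprMn.
rewrite /G !split_g' !rmorphM !fmorphV !rmorphXn /= !split_mon /g' /G0.
rewrite !exprMn expfB_leq ?fmorph_eq0 //.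
have gl0 : iota (g l) != 0 by rewrite fmorph_eq0.
have P0 : \prod_(y | y != l) iota (g y) ^+ al j y != 0.
  by apply/prodf_neq0 => y _; rewrite expf_neq0 // fmorph_eq0.
set P := \prod_(y | y != l) iota (g y) ^+ al j y in P0 *.
set Q := \prod_(y | y != l) iota (g y) ^+ mu y.
set sa := (\sum_(y | y != l) al j y)%N; set sm := (\sum_(y | y != l) mu y)%N.
have ea : (al j l + sa = N * ii j)%N by rewrite -al_sum (bigD1 l).
have em : (mu l + sm = N * (p * ii j - i))%N by rewrite -smu (bigD1 l).
have et : (k * ii j * p + sa * p = k * (p * ii j - i) + (N + k) * i + (mu l - p * al j l) + sm)%N.
  by nia.
rewrite -!exprM; have [gp pp] : iota (g l) ^+ (al j l * p) != 0 /\ P ^+ p != 0.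
  by rewrite !expf_neq0.
have := congr1 (fun n => tau ^+ n) et; rewrite !exprD => et'.
transitivity (iota r * (iota (g l) ^+ mu l * Q) * iota z ^+ i / iota (g l) ^+ (al j l * p)
   * (tau ^+ (k * ii j * p) * tau ^+ (sa * p))).
  by field; rewrite gp pp.
rewrite et' [(p * al j l)%N]mulnC. by field; rewrite gp.
Qed.

Lemma frobenius_span_power j : frobenius_span j (e j ^+ p).
Proof.
rewrite /e expr_div_n -exprM mulnC.
elim: (power_reduction (p * ii j)) => [|x y Gx _ IH].
  by rewrite mul0r; apply: frobenius_span0.
by rewrite mulrDl; apply: frobenius_spanD => //; apply: frobenius_span_term.
Qed.

Lemma additive_decomposition : exists (y : J -> E -> K) (w : E -> K),
  [/\ forall m, z ^+ ii m / mon (al m) = \sum_l y l m + w m,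
      forall m, wt (k * ii m) (w m) &
      forall l m, Int (iota (y l m) * G l m)].
Proof.
have /choice[A /choice[u Au]] := frobenius_span_power.
have /choice[y ey] l := frobenius_system_solvable charKp A (u^~ l).
pose w m := e m - \sum_l y l m.
exists y, w; split=> [m||l].
- by rewrite addrC subrK.
- apply: (@scaled_system_integral _ A (fun=> 0) w G0) => // [j|j m|j].
  + have [ej _ _] := Au j.
    (* By additivity of Frobenius the error terms cancel in this difference, which leaves the
       homogeneous system with the same matrix. *)
    have -> : w j ^+ p = e j ^+ p - \sum_l y l j ^+ p.
      by rewrite /w -[p in LHS]expn1 (pchar_exprB charKp) (pchar_sum_expr charKp) expn1.
    under eq_bigr do rewrite ey; rewrite ej addr0.
    under [in RHS]eq_bigr do rewrite mulrBr mulr_sumr.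
    rewrite sumrB big_split /= exchange_big /= opprD addrACA subrr addr0.
    by [].
  + by have [_ /(_ m)[]] := Au j.
  + by rewrite rmorph0 mul0r; apply: integral0.
- apply: (@scaled_system_integral _ A (u^~ l) (y l) (G l)) => // [j m|j].
  + by have [_ /(_ m)[_]] := Au j.
  + by have [_ _] := Au j.
Qed.

End Induction.

Lemma division : exists (eta : J -> K) (w : K),
  [/\ z = \sum_l g l * eta l + \prod_l g l * w,
      forall l, wt (N.-1 + k) (eta l) & wt k w].
Proof.
(* The index set is finite: [|al| = N i] with [i <= d] bounds every exponent by [N * d]. *)
pose E := {x : {ffun J -> 'I_(N * d).+1} * 'I_d.+1 |
  \sum_l x.1 l == N * x.2}%N.
pose al (m : E) (l : J) : nat := (val m).1 l.
pose ii (m : E) : nat := (val m).2.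
have al_sum m : (\sum_l al m l = N * ii m)%N by have /eqP := valP m.
have E_full (mu : J -> nat) i : (i <= d)%N ->
    (\sum_l mu l = N * i)%N -> exists m : E, al m =1 mu /\ ii m = i.
  move=> id smu.
  have le_mu l : (mu l < (N * d).+1)%N.
    rewrite ltnS (@leq_trans (N * i)) ?leq_mul2l ?id ?orbT //.
    by rewrite -smu (bigD1 l) //= leq_addr.
  have id' : (i < d.+1)%N by [].
  have P : (\sum_l ([ffun l => Ordinal (le_mu l)], Ordinal id').1 l == N * i)%N.
    by rewrite -smu; apply/eqP/eq_bigr => l _; rewrite ffunE.
  pose m : E := exist _ ([ffun l => Ordinal (le_mu l)], Ordinal id') P.
  by exists m; split=> // l; rewrite /al /= ffunE.
have [y [w [ez iw iy]]] := additive_decomposition al_sum E_full.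
(* The entry with all exponents 1 and [i = 1] is [z] divided by the product of the [g l];
   multiplying its decomposition by that product gives the claim. *)
have [|m [alm iim]] := E_full (fun=> 1%N) 1%N d_gt0.
  by rewrite sum1_card muln1.
have := ez m; rewrite iim expr1.
have -> : mon (al m) = \prod_l g l by apply: eq_bigr => l _; rewrite alm.
have g0 : \prod_l g l != 0 by apply/prodf_neq0.
(* For this entry [G l m] is the product of the [g x], [x != l], times [tau ^+ (N.-1 + k)], so
   integrality of [y l m] scaled by it is the asserted weight. *)
move=> {}ez; exists (fun l => \prod_(x | x != l) g x * y l m), (w m); split=> [|l|].
- have -> : \sum_l g l * (\prod_(x | x != l) g x * y l m) =
      \prod_l g l * \sum_l y l m.
    rewrite mulr_sumr; apply: eq_bigr => l _.
    by rewrite mulrA [in RHS](bigD1 l).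
  by rewrite -mulrDr -ez mulrCA divff ?mulr1.
- have := iy l m; rewrite iim muln1; congr integralOver.
  rewrite rmorphM rmorph_prod.
  have -> : \prod_(x | x != l) (iota (g x) * tau) ^+ al m x =
      \prod_(x | x != l) iota (g x) * tau ^+ N.-1.
    have -> : N.-1 = #|[pred x | x != l]| by rewrite cardC1.
    rewrite -prodr_const -big_split /=.
    by apply: eq_bigr => x _; rewrite alm expr1.
  by rewrite exprD; ring.
- by have := iw m; rewrite iim muln1.
Qed.

End Division.

(** * Ideal powers and the Rees algebra *)

(* The powers of the ideal [(t_1, ..., t_n)]; unlike [ideal_pow] this form passes
   directly through ultraproducts. *)
Fixpoint ipow (A : comPzRingType) n (t : 'I_n -> A) (s : nat) (x : A) : Prop :=
  if s is s'.+1 then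
    exists b, (forall l, ipow t s' (b l)) /\ x = \sum_l b l * t l
  else True.

Section IdealPowers.
Variables (A : comPzRingType) (n : nat) (t : 'I_n -> A).

Lemma ipow0 s : ipow t s 0.
Proof.
elim: s => //= s IH; exists (fun=> 0); split=> //.
by rewrite big1 // => l _; rewrite mul0r.
Qed.

Lemma ipowD s x y : ipow t s x -> ipow t s y -> ipow t s (x + y).
Proof.
elim: s x y => //= s IH x y [b [ib ->]] [c [ic ->]].
exists (fun l => b l + c l); split=> [l|]; first exact: IH.
by rewrite -big_split; apply: eq_bigr => l _; rewrite mulrDl.
Qed.

Lemma ipow_sum s (J : Type) (r : seq J) (P : pred J) (F : J -> A) :
  (forall j, P j -> ipow t s (F j)) -> ipow t s (\sum_(j <- r | P j) F j).
Proof. by move=> iF; apply: (big_ind (ipow t s) (ipow0 s) (@ipowD s)). Qed.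

Lemma ipowM s s' x y : ipow t s x -> ipow t s' y -> ipow t (s + s') (x * y).
Proof.
elim: s x => [|s IH] x /=.
  move=> _; rewrite add0n; elim: s' y => //= s' IH y [b [ib ->]].
  exists (fun l => x * b l); split=> [l|]; first exact: IH.
  by rewrite mulr_sumr; apply: eq_bigr => l _; rewrite mulrA.
move=> [b [ib ->]] iy; exists (fun l => b l * y); split=> [l|]; first exact: IH.
by rewrite mulr_suml; apply: eq_bigr => l _; rewrite mulrAC.
Qed.

Lemma ipowMl s a x : ipow t s x -> ipow t s (a * x).
Proof. exact: (@ipowM 0). Qed.

Lemma ipowMr s x l : ipow t s x -> ipow t s.+1 (x * t l).
Proof.
move=> ix /=; exists (fun l' => if l' == l then x else 0); split=> [l'|].
  by case: eqP => // _; apply: ipow0.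
rewrite (bigD1 l) //= eqxx big1 ?addr0 // => l' /negPf->.
by rewrite mul0r.
Qed.

Lemma ipow_prod D s (v : 'I_s -> A) :
  (forall i, ipow t D (v i)) -> ipow t (D * s) (\prod_i v i).
Proof.
elim: s v => [|s IH] v iv; first by rewrite muln0.
by rewrite big_ord_recl mulnS; apply: ipowM => //; apply: IH.
Qed.

End IdealPowers.

Lemma ipow_map (A A' : comPzRingType) n (t : 'I_n -> A) (t' : 'I_n -> A')
    (f : {rmorphism A -> A'}) s x :
  (forall l, f (t l) = t' l) -> ipow t s x -> ipow t' s (f x).
Proof.
move=> ft; elim: s x => //= s IH x [b [ib ->]].
exists (fun l => f (b l)); split=> [l|]; first exact: IH.
by rewrite rmorph_sum; apply: eq_bigr => l _; rewrite rmorphM ft.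
Qed.

Section Rees.
Variables (S : comNzRingType) (n : nat) (t : 'I_n -> S).

Definition rees_pred : pred {poly S} :=
  fun q => `[< forall i, ipow t i q`_i >].

Fact rees_subring : subring_closed rees_pred.
Proof.
split=> [|x y /asboolP ix /asboolP iy|x y /asboolP ix /asboolP iy];
  apply/asboolP => i.
- rewrite coef1; case: i => [|i] //=; exact: (ipow0 t i.+1).
- by rewrite coefB -mulN1r; apply: ipowD => //; apply: ipowMl.
- rewrite coefM; apply: ipow_sum => j _.
  by rewrite -[i in ipow t i _](subnKC (ltn_ord j : j <= i)%N); apply: ipowM.
Qed.
HB.instance Definition _ := GRing.isSubringClosed.Build {poly S} rees_pred rees_subring.

Definition rees : Type := {q : {poly S} | rees_pred q}.
HB.instance Definition _ := SubChoice.on rees.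
HB.instance Definition _ := [SubChoice_isSubComNzRing of rees by <:].

Fact rees_monom_proof s x : ipow t s x -> rees_pred (x *: 'X^s).
Proof.
move=> ix; apply/asboolP => i; rewrite coefZ coefXn.
by case: eqP => [->|_]; rewrite ?mulr1 // mulr0; apply: ipow0.
Qed.

Definition rees_monom s x (ix : ipow t s x) : rees :=
  exist _ (x *: 'X^s) (rees_monom_proof ix).

Lemma rees_coef (q : rees) i : ipow t i (val q)`_i.
Proof. by have /asboolP := valP q; apply. Qed.

End Rees.

(** * The Briançon-Skoda inclusion in characteristic [p] *)

Section PlusClosure.
Variables (K : closedFieldType) (p : nat) (charKp : p \in [pchar K]).
Variables (S : comNzRingType) (sigma : {rmorphism S -> K}).
Hypothesis S_closed : forall x, integralOver sigma x -> exists y, sigma y = x.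
Variables (n : nat) (n_gt0 : (0 < n)%N) (t : 'I_n -> S).

Local Notation L := {fraction {poly K}}.
Let phi : {rmorphism rees t -> L} :=
  (@tofrac {poly K}) \o (map_poly sigma) \o (val : rees t -> {poly S}).
Let iota : {rmorphism K -> L} := (@tofrac {poly K}) \o (@polyC K).
Let tau : L := tofrac 'X.

Let tau_neq0 : tau != 0.
Proof. by rewrite tofrac_eq0 polyX_eq0. Qed.

Definition rees_wt D x := wt phi iota tau D x.

Lemma ipow_wt s x : ipow t s x -> rees_wt s (sigma x).
Proof.
move=> ix; rewrite /rees_wt /wt.
have -> : iota (sigma x) * tau ^+ s = phi (rees_monom ix).
  by rewrite /= map_polyZ map_polyXn -mul_polyC rmorphM rmorphXn.
exact: integral_id.
Qed.

(** Together with [equation_wt] this identifies weight [D] with integrality over the [D]-th power of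
    the ideal generated by [t]: take the homogeneous part of a monic relation for [x 'X^D] over the
    Rees algebra. *)
Lemma wt_equation D x : rees_wt D x -> exists d (a : nat -> S),
  [/\ (0 < d)%N, forall i, ipow t (D * i) (a i) &
      x ^+ d = \sum_(1 <= i < d.+1) sigma (a i) * x ^+ (d - i)].
Proof.
case=> P monP rootP; pose d := (size P).-1.
have sP : size P = d.+1 by rewrite prednK // lt0n size_poly_eq0 monic_neq0.
pose c i := val P`_i.
have eP : \sum_(i < d.+1) map_poly sigma (c i) * (x ^+ i *: 'X^(D * i)) = 0.
  apply/eqP; rewrite -tofrac_eq0 rmorph_sum /=; apply/eqP.
  move: rootP; rewrite rootE [map_poly phi P]/map_poly horner_poly sP => /eqP e0.
  rewrite -[RHS]e0; apply: eq_bigr => i _; rewrite rmorphM; congr (_ * _).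
  by rewrite -mul_polyC rmorphM !rmorphXn exprMn -exprM.
have cd : c d = 1.
  by have := monicP monP; rewrite /lead_coef sP /= /c => ->.
exists d, (fun i => - (c (d - i)%N)`_(D * i)); split.
- rewrite lt0n; apply: contraTneq rootP => d0.
  have -> : P = 1.
    have P1 : (size P <= 1)%N by rewrite sP d0.
    by have := monicP monP; rewrite (size1_polyC P1) lead_coefC => ->.
  by rewrite rmorph1 root1.
- by move=> i; rewrite -mulN1r; apply: ipowMl; apply: rees_coef.
(* In degree [D * d] the term with [x ^+ i] contributes exactly the coefficient of degree
   [D * (d - i)] of [c i]. *)
- move/(congr1 (fun q : {poly K} => q`_(D * d))): eP; rewrite coef0 coef_sum.
  have ec (i : 'I_d.+1) : (map_poly sigma (c i) * (x ^+ i *: 'X^(D * i)))`_(D * d) =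
      sigma (c i)`_(D * (d - i)) * x ^+ i.
    rewrite -scalerAr coefZ coefMXn ltn_mul2l (leq_gtF (leq_ord i)) andbF.
    by rewrite coef_map -mulnBr mulrC.
  rewrite (eq_bigr _ (fun i _ => ec i)) big_ord_recr /= subnn muln0 cd coef1 rmorph1 mul1r.
  move/eqP; rewrite addrC addr_eq0 => /eqP->; rewrite -sumrN.
  rewrite big_add1 /= big_mkord (reindex_inj rev_ord_inj) /=.
  apply: eq_bigr => i _; rewrite subKn; last by case: i.
  by rewrite rmorphN mulNr.
Qed.

Lemma equation_wt D d (a : nat -> S) x :
    (forall i, (1 <= i <= d)%N -> ipow t (D * i) (a i)) ->
    x ^+ d = \sum_(1 <= i < d.+1) sigma (a i) * x ^+ (d - i) ->
  rees_wt D x.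
Proof.
move=> ia ex.
apply: (@integral_equation _ _ _ d (fun i => iota (sigma (a i)) * tau ^+ (D * i))).
  by move=> i id; apply: ipow_wt; apply: ia.
rewrite exprMn -rmorphXn ex rmorph_sum mulr_suml !big_nat.
apply: eq_bigr => i /andP[_ id].
have -> : (tau ^+ D) ^+ d = tau ^+ (D * i) * (tau ^+ D) ^+ (d - i).
  by rewrite -!exprM -exprD -mulnDr subnKC.
by rewrite rmorphM rmorphXn exprMn; ring.
Qed.

Lemma wt_S D x : rees_wt D x -> exists y, sigma y = x.
Proof.
case/wt_equation => d [a [_ _ ex]]; apply: S_closed.
apply: (@integral_equation _ _ sigma d (fun i => sigma (a i))) => // i _.
exact: integral_id.
Qed.

(** The division step needs nonzero generators, so those with zero image in [K] are set aside. *)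
Local Notation live := {l : 'I_n | sigma (t l) != 0}.
Let g (l : live) : K := sigma (t (val l)).

(** Supplies the terms required by [coef_term]: [s] generators are peeled off one at a time, and a
    product containing a generator with zero image vanishes. *)
Lemma ipow_addcl s s' x : ipow t (s + s') x ->
  addcl (fun u => exists r (mu : live -> nat),
    [/\ u = sigma r * \prod_l g l ^+ mu l, (\sum_l mu l = s)%N & ipow t s' r])
    (sigma x).
Proof.
elim: s x => [|s IH] x /=.
  move=> ix; apply: addcl_gen; exists x, (fun=> 0%N).
  by split=> //; rewrite big1 ?mulr1 // => l _; rewrite expr0.
move=> [b [ib ->]]; rewrite rmorph_sum; apply: addcl_sum => l _.
rewrite rmorphM; have [->|tl] := eqVneq (sigma (t l)) 0.
  by rewrite mulr0; apply: addcl0.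
apply: (addcl_map (f := *%R^~ (sigma (t l)))) (IH _ (ib l)) => [|u v|_ [r [mu [-> smu ir]]]].
- by rewrite mul0r.
- by rewrite mulrDl.
pose l' : live := exist _ l tl.
apply: addcl_gen; exists r, (fun m => (m == l') + mu m)%N; split=> //.
- rewrite -mulrA; congr (_ * _); rewrite (bigD1 l') //= [in RHS](bigD1 l') //= eqxx.
  rewrite exprS mulrC mulrA; congr (_ * _).
  by apply: eq_bigr => m /negPf->.
- rewrite big_split /= smu (bigD1 l') //= eqxx big1 ?addn0 // => m /negPf->.
  by [].
Qed.

(** Induction on [j]: [division] writes [x] as a combination of generators whose coefficients have
    weight one less, so the induction hypothesis puts them in the [j]-th power. *)
Lemma briancon_skoda_plus j x :
  rees_wt (n.-1 + j) x -> exists y, sigma y = x /\ ipow t j y.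
Proof.
elim: j x => [|j IH] x wx; first by have [y <-] := wt_S wx; exists y.
have [d [a [d_gt0 ia ex]]] := wt_equation wx.
have le_live : (#|{: live}| <= n)%N.
  by rewrite card_sig (leq_trans (max_card _)) ?card_ord.
(* Without live generators the coefficients [a i] lie in positive powers of an ideal with zero
   image, so [x ^+ d = 0]. *)
have [live0|live_gt0] := posnP #|{: live}|.
  have t0 l : sigma (t l) = 0.
    apply/eqP/negPn/negP => tl; have := fintype0 _ live0.
    by apply; exists l.
  exists 0; split; last exact: ipow0.
  rewrite rmorph0; apply/esym/eqP; have : x ^+ d == 0.
    rewrite ex big_nat big1 // => i /andP[i_gt0 _]; have := ia i.
    case Di: (_ * i)%N => [|q] /=; first by nia.
    move=> [b [_ ->]].
    rewrite rmorph_sum big1 ?mul0r // => l _.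
    by rewrite rmorphM t0 mulr0.
  by rewrite expf_eq0 => /andP[].
(* The discarded generators are added to [k], so that the weight of [x] stays [n.-1 + j.+1]. *)
pose k := (n - #|{: live}| + j)%N.
have ek : (n.-1 + j.+1 = #|{: live}| + k)%N.
  by rewrite /k addnA subnKC // addnS -addSn prednK.
have g_neq0 (l : live) : g l != 0 by exact: (valP l).
have t_wt l : rees_wt 1 (sigma (t l)).
  apply: ipow_wt; exists (fun l' => (l' == l)%:R); split=> //.
  by rewrite (bigD1 l) //= eqxx mul1r big1 ?addr0 // => l' /negPf->; rewrite mul0r.
have a_coef i : (1 <= i <= d)%N -> addcl (coef_term phi iota tau g k i) (sigma (a i)).
  move=> _; have := ia i; rewrite ek mulnDl => /ipow_addcl ai.
  apply: (addcl_map (f := id)) ai => // _ [r [mu [-> smu ir]]].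
  apply: addcl_gen; exists (sigma r), mu.
  by split; [reflexivity | apply: smu | apply: (ipow_wt ir)].
have x_wt : rees_wt (#|{: live}| + k) x by rewrite -ek.
have [eta [w [ez eta_wt w_wt]]] :=
  division charKp tau_neq0 g_neq0 (fun l => t_wt (val l)) d_gt0 x_wt ex a_coef.
have ek' : (#|{: live}|.-1 + k = n.-1 + j)%N by rewrite /k; lia.
have /choice[y hy] (l : live) : exists y, sigma y = eta l /\ ipow t j y.
  by apply: IH; rewrite -ek'; apply: eta_wt.
(* The last term of [division] is absorbed into one generator [l0]: its cofactor has weight
   [#|live|.-1 + k = n.-1 + j], as the [eta l] do. *)
have /card_gt0P[l0 _] := live_gt0.
have [|y0 [ey0 iy0]] := IH (\prod_(l | l != l0) g l * w).
  rewrite -ek'; apply: wtM; last exact: w_wt.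
  have -> : #|{: live}|.-1 = (\sum_(l : live | l != l0) 1)%N.
    by rewrite sum1_card -(cardC1 l0).
  apply: (big_rec2 (fun u m => wt phi iota tau m u)) => [|l m u _ wu].
    by rewrite /wt rmorph1 mulr1; apply: integral1.
  by apply: wtM; [apply: t_wt | apply: wu].
exists (\sum_l y l * t (val l) + y0 * t (val l0)); split.
  rewrite rmorphD rmorph_sum rmorphM ey0 ez; congr (_ + _); last first.
    by rewrite [in RHS](bigD1 l0) //= {2}/g; ring.
  by apply: eq_bigr => l _; rewrite rmorphM mulrC; case: (hy l) => ->.
apply: ipowD; last exact: ipowMr.
by apply: ipow_sum => l _; apply: ipowMr; case: (hy l).
Qed.

End PlusClosure.

Lemma int_cl_closed (A : idomainType) (K : alg_closure {fraction A}) (x : K) :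
  integralOver (val : int_cl K -> K) x -> exists y : int_cl K, val y = x.
Proof.
case=> P monP rootP.
have xP : int_pred x.
  apply/asboolP; apply: (integral_root_monic (monic_map _ monP) rootP).
  apply/integral_poly => i; rewrite coef_map.
  exact/asboolP/(valP P`_i).
by exists (exist _ x xP).
Qed.

Lemma int_cl_briancon_skoda (A : idomainType) (K : alg_closure {fraction A})
    (p : nat) (charAp : p \in [pchar A]) (n k d : nat) (t : 'I_n -> int_cl K)
    (z : int_cl K) (a : nat -> int_cl K) :
    (0 < n)%N ->
    (forall i, (1 <= i <= d)%N -> ipow t ((n + k) * i) (a i)) ->
    z ^+ d = \sum_(1 <= i < d.+1) a i * z ^+ (d - i) ->
  ipow t k.+1 z.
Proof.
move=> n_gt0 ia ez.
have charKp : p \in [pchar K].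
  exact: (rmorph_pchar (@to_closure A K) charAp).
pose sigma : {rmorphism int_cl K -> K} := val : int_cl K -> K.
have wz : rees_wt sigma t (n.-1 + k.+1) (sigma z).
  apply: (equation_wt (d := d) (a := a)) => [i id|].
    by rewrite addnS -addSn prednK //; apply: ia.
  rewrite -rmorphXn ez rmorph_sum; apply: eq_bigr => i _.
  by rewrite rmorphM rmorphXn.
have [y [/val_inj <- //]] :=
  briancon_skoda_plus charKp (@int_cl_closed A K) n_gt0 wz.
Qed.

Lemma plus_briancon_skoda (A : comPzRingType)
    (K : forall H : is_domain A, alg_closure {fraction dom H})
    (p : nat) (n k d : nat) (t : 'I_n -> plus K) (z : plus K) (a : nat -> plus K) :
    prime p -> p%:R = 0 :> A -> (0 < n)%N ->
    (forall i, (1 <= i <= d)%N -> ipow t ((n + k) * i) (a i)) ->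
    z ^+ d = \sum_(1 <= i < d.+1) a i * z ^+ (d - i) ->
  ipow t k.+1 z.
Proof.
move=> p_prime p0 n_gt0; rewrite /plus in t z a *.
(* Outside domains [plus] is the zero ring, where [z = 0]. *)
case: (pselect (is_domain A)) t z a => [H|H] t z a; last first.
  by move=> _ _; case: z; apply: (ipow0 t k.+1).
apply: (@int_cl_briancon_skoda _ (K H) p) => //.
by rewrite inE p_prime; apply/eqP.
Qed.

(** * Points over an algebraically closed field *)

Section ExtensionOfPoints.
Variables (k : closedFieldType) (L : fieldType).

(** Density of [k]-points: [rho] is a generic point of the variety cut out by its kernel, and each
    nonempty basic open set of it contains a [k]-point. *)
Definition has_points (A : comNzRingType) (j : {rmorphism k -> A})
    (rho : {rmorphism A -> L}) : Prop :=
  forall u, rho u != 0 -> exists sigma : {rmorphism A -> k},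
    [/\ forall c, sigma (j c) = c, sigma u != 0 &
        forall g, rho g = 0 -> sigma g = 0].

(* If [b] is transcendental over [A], avoid the zeros of one coefficient of [u];
   otherwise take a root of the image of a relation [f] of minimal degree, where a
   Bezout identity for [f] and [u] keeps [u] from vanishing. *)
Lemma has_points_poly (A : comNzRingType) (j : {rmorphism k -> A})
    (rho : {rmorphism A -> L}) (b : L) : has_points j rho ->
  has_points ((@polyC A) \o j) ((horner_eval b) \o (map_poly rho)).
Proof.
move=> ptA u /=; rewrite /horner_eval => ub.
pose ev (sigma : {rmorphism A -> k}) x : {rmorphism {poly A} -> k} :=
  (horner_eval x) \o (map_poly sigma).
have ker (sigma : {rmorphism A -> k}) (g : {poly A}) :
    (forall c, rho c = 0 -> sigma c = 0) ->
    map_poly rho g = 0 -> map_poly sigma g = 0.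
  move=> sk /polyP g0; apply/polyP => i; rewrite coef_map coef0; apply: sk.
  by rewrite -coef_map g0 coef0.
(* Dropping the top coefficients killed by [rho] makes the leading coefficient nonzero under [rho],
   as pseudo-division by such a polynomial requires. *)
have trunc (g : {poly A}) : exists g', map_poly rho g' = map_poly rho g /\
    size g' = size (map_poly rho g').
  pose g' := \poly_(i < size (map_poly rho g)) g`_i.
  have e : map_poly rho g' = map_poly rho g.
    apply/polyP => i; rewrite coef_map [g'`__]coef_poly.
    case: ltnP => [_|gi]; first by rewrite coef_map.
    by rewrite raddf0 nth_default.
  exists g'; split=> //; apply/eqP; rewrite eqn_leq {1}e size_poly /=.
  by apply: size_poly.
pose alg n := `[< exists f : {poly A}, [/\ map_poly rho f != 0,
  (map_poly rho f).[b] = 0 & size (map_poly rho f) = n] >].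
have [ex_alg|trans] := pselect (exists n, alg n); last first.
  have map0 (g : {poly A}) : (map_poly rho g).[b] = 0 -> map_poly rho g = 0.
    move=> gb; apply/eqP/negPn/negP => g0.
    by apply: trans; exists (size (map_poly rho g)); apply/asboolP; exists g.
  have uneq : map_poly rho u != 0 by apply: contraNneq ub => ->; rewrite horner0.
  have [|sigma [sj su sk]] := ptA u`_(size (map_poly rho u)).-1.
    by rewrite -coef_map -lead_coefE lead_coef_eq0.
  have /closed_nonrootP[x xu] : map_poly sigma u != 0.
    apply: contraNneq su => /polyP/(_ (size (map_poly rho u)).-1).
    by rewrite coef_map coef0 => ->.
  exists (ev sigma x); split=> [c||g] /=; rewrite /horner_eval.
  - by rewrite map_polyC hornerC; apply: sj.
  - exact: xu.
  - by move=> /map0/(ker sigma g sk)->; rewrite horner0.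
have [d /asboolP[f0 [f0_neq0 f0b f0d]] min_d] := ex_minnP ex_alg.
have [f [ef sf]] := trunc f0.
have {f0 ef f0_neq0 f0b f0d} [f_neq0 fb fd] : [/\ map_poly rho f != 0,
    (map_poly rho f).[b] = 0 & size (map_poly rho f) = d] by rewrite ef.
have {}min_d (g : {poly A}) : (size (map_poly rho g) < d)%N ->
    (map_poly rho g).[b] = 0 -> map_poly rho g = 0.
  move=> gd gb; apply/eqP/negPn/negP => g0; move: gd; rewrite ltnNge min_d //.
  by apply/asboolP; exists g.
have lead_neq0 (g : {poly A}) : size g = size (map_poly rho g) ->
    map_poly rho g != 0 -> rho (lead_coef g) != 0.
  by move=> sg g0; rewrite lead_coefE -coef_map sg -lead_coefE lead_coef_eq0.
have size_mapW (g : {poly A}) : (size (map_poly rho g) <= size g)%N.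
  exact: size_poly.
have divide (g h : {poly A}) : size h = size (map_poly rho h) -> map_poly rho h != 0 ->
    exists N q r, lead_coef h ^+ N *: g = q * h + r /\ (size r < size h)%N.
  move=> sh h0; exists (Pdiv.Ring.rscalp g h), (Pdiv.Ring.rdivp g h), (Pdiv.Ring.rmodp g h).
  split; first exact: Pdiv.ComRing.rdivp_eq.
  by rewrite Pdiv.Ring.ltn_rmodp -size_poly_eq0 sh size_poly_eq0.
(* Euclid's algorithm by pseudo-division of [f] by [r]: minimality of [d] keeps the quotient nonzero
   at [b], so the remainder is again nonzero at [b], and the sizes drop until a constant is left. *)
have bezout (r : {poly A}) : (size (map_poly rho r) < d)%N -> (map_poly rho r).[b] != 0 ->
    exists al be c, rho c != 0 /\ map_poly rho (al * r + be * f - c%:P) = 0.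
  have [n] := ubnP (size (map_poly rho r)); elim: n r => // n IH r'; rewrite ltnS.
  have [r [er sr]] := trunc r'; rewrite -er => rn rd rb.
  have r_neq0 : map_poly rho r != 0 by apply: contraNneq rb => ->; rewrite horner0.
  have [r1|r1] := leqP (size r) 1.
    have rc := size1_polyC r1.
    exists 1, 0, r`_0; split; last first.
      by rewrite mul1r mul0r addr0 -rc rmorphB /= er subrr.
    by rewrite rc map_polyC hornerC in rb.
  have [N [q [s [e ss]]]] := divide f r sr r_neq0.
  have lr := lead_neq0 r sr r_neq0.
  have map_e : rho (lead_coef r) ^+ N *: map_poly rho f =
      map_poly rho q * map_poly rho r + map_poly rho s.
    by rewrite -rmorphXn -map_polyZ e rmorphD rmorphM.
  have s_lt : (size (map_poly rho s) < size (map_poly rho r))%N.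
    by rewrite -sr; apply: leq_ltn_trans ss.
  have qr : size (map_poly rho q * map_poly rho r) = d.
    have -> : map_poly rho q * map_poly rho r =
      rho (lead_coef r) ^+ N *: map_poly rho f - map_poly rho s by rewrite map_e addrK.
    rewrite size_polyDl ?size_polyN size_scale ?fd ?expf_neq0 //.
    exact: ltn_trans s_lt rd.
  have q_neq0 : map_poly rho q != 0.
    apply: contraTneq rd => q0; move: qr; rewrite q0 mul0r size_poly0 => <-.
    by rewrite ltn0.
  have qd : (size (map_poly rho q) < d)%N.
    by move: qr r1; rewrite size_mul // -sr; move: (size _) (size _) => a1 a2; lia.
  have sb : (map_poly rho s).[b] != 0.
    have -> : map_poly rho s = rho (lead_coef r) ^+ N *: map_poly rho f
      - map_poly rho q * map_poly rho r by rewrite map_e addrC addKr.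
    rewrite hornerD hornerN hornerZ fb mulr0 add0r oppr_eq0 hornerM mulf_neq0 //.
    by apply: contraNneq q_neq0 => qb; rewrite (min_d q).
  have [||al [be [c [c0 ec]]]] := IH s _ _ sb.
  - exact: leq_trans s_lt rn.
  - exact: ltn_trans s_lt rd.
  exists (- al * q), (al * (lead_coef r ^+ N)%:P + be), c; split=> //.
  rewrite rmorphB rmorphD rmorphM /= -er -rmorphM -rmorphD -rmorphB -ec.
  congr (map_poly rho _).
  have -> : s = lead_coef r ^+ N *: f - q * r by rewrite e addrC addKr.
  by rewrite -!mul_polyC; ring.
have [N [q [r [e sr]]]] := divide u f sf f_neq0.
have lf := lead_neq0 f sf f_neq0.
have rd : (size (map_poly rho r) < d)%N.
  by rewrite -fd -sf; apply: leq_ltn_trans sr.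
have rb : (map_poly rho r).[b] != 0.
  have -> : r = lead_coef f ^+ N *: u - q * f by rewrite e addrC addKr.
  rewrite rmorphB rmorphM /= map_polyZ hornerD hornerN hornerZ hornerM fb mulr0 subr0.
  by rewrite mulf_neq0 // rmorphXn expf_neq0.
have [al [be [c [c0 ec]]]] := bezout r rd rb.
(* The point must keep [lead_coef f] nonzero, so that [f] stays nonconstant and has a root, and [c]
   nonzero, so that the Bezout identity keeps [r] nonzero at that root. *)
have [|sigma [sj sac sk]] := ptA (lead_coef f * c); first by rewrite rmorphM mulf_neq0.
move: sac; rewrite rmorphM mulf_eq0 negb_or => /andP[sa sc].
have /closed_rootP[x /eqP fx] : size (map_poly sigma f) != 1%N.
  rewrite (size_map_poly_id0 _) //; apply: contraTneq f_neq0 => f1.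
  rewrite negbK; have f1' : (size f <= 1)%N by rewrite f1.
  move: fb; rewrite (size1_polyC f1') map_polyC hornerC => ->.
  by rewrite polyC0.
have rx : (map_poly sigma r).[x] != 0.
  apply: contraNneq sc => rx; have /(congr1 (horner_eval x)) := ker sigma _ sk ec.
  rewrite /horner_eval rmorphB rmorphD !rmorphM /= map_polyC hornerD hornerN hornerD !hornerM.
  by rewrite rx fx !mulr0 add0r add0r hornerC horner0 => /eqP; rewrite oppr_eq0.
exists (ev sigma x); split=> [c'||g] /=; rewrite /horner_eval.
- by rewrite map_polyC hornerC; apply: sj.
- apply: contraNneq rx => ux.
  have -> : r = lead_coef f ^+ N *: u - q * f by rewrite e addrC addKr.
  rewrite rmorphB rmorphM /= map_polyZ hornerD hornerN hornerZ hornerM fx mulr0 subr0.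
  by rewrite ux mulr0.
(* A polynomial vanishing at [b] is, up to a power of [lead_coef f] and modulo the kernel of [rho],
   a multiple of [f]: its remainder is too small to be a nonzero relation. *)
- move=> gb; have [M [q' [r' [e' sr']]]] := divide g f sf f_neq0.
  have r'0 : map_poly rho r' = 0.
    apply: min_d; first by rewrite -fd -sf; apply: leq_ltn_trans sr'.
    have -> : r' = lead_coef f ^+ M *: g - q' * f by rewrite e' addrC addKr.
    by rewrite rmorphB rmorphM /= map_polyZ hornerD hornerN hornerZ hornerM fb gb !mulr0 subr0.
  have := congr1 (fun h => (map_poly sigma h).[x]) e'.
  rewrite map_polyZ rmorphD rmorphM /= (ker sigma r' sk r'0) addr0 hornerZ hornerM fx mulr0.
  by move/eqP; rewrite rmorphXn mulf_eq0 expf_eq0 (negPf sa) andbF => /eqP.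
Qed.

End ExtensionOfPoints.

(** The ring [A] is an iterated polynomial ring over [k], with one variable adjoined for each
    coordinate [xi i]. *)
Lemma generic_point (k : closedFieldType) (L : fieldType)
    (iota : {rmorphism k -> L}) (xi : nat -> L) (m : nat) :
  exists (A : comNzRingType) (j : {rmorphism k -> A}) (rho : {rmorphism A -> L})
    (x : nat -> A), [/\ forall c, rho (j c) = iota c,
      forall i, (i < m)%N -> rho (x i) = xi i & has_points j rho].
Proof.
elim: m => [|m [A [j [rho [x [rj rx pts]]]]]].
  exists k, idfun, iota, (fun=> 0); split=> // u u0.
  exists idfun; split=> // [|g /eqP]; last by rewrite fmorph_eq0 => /eqP.
  by apply: contraNneq u0 => /= ->; rewrite rmorph0.
exists {poly A}, ((@polyC A) \o j), ((horner_eval (xi m)) \o (map_poly rho)),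
  (fun i => if (i < m)%N then (x i)%:P else 'X); split.
- by move=> c /=; rewrite /horner_eval map_polyC hornerC; apply: rj.
- move=> i; rewrite ltnS leq_eqVlt /= /horner_eval => /predU1P[->|im].
    by rewrite ltnn map_polyX hornerX.
  by rewrite im map_polyC hornerC; apply: rx.
- exact: has_points_poly.
Qed.

Lemma mmap_rmorph (R : nzRingType) (A B : comNzRingType) (f : {rmorphism A -> B})
    (j : {rmorphism R -> A}) (g : {rmorphism R -> B}) m (x : 'I_m -> A) (y : 'I_m -> B) q :
  (forall c, f (j c) = g c) -> (forall i, f (x i) = y i) ->
  f (mmap j x q) = mmap g y q.
Proof.
move=> fj fx; rewrite /mmap rmorph_sum; apply: eq_bigr => mu _.
rewrite rmorphM fj; congr (_ * _); rewrite /mmap1 rmorph_prod.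
by apply: eq_bigr => i _; rewrite rmorphXn fx.
Qed.

Lemma nullstellensatz (k : closedFieldType) (L : fieldType)
    (iota : {rmorphism k -> L}) m (xi : 'I_m -> L) (u : {mpoly k[m]}) :
  mmap iota xi u != 0 -> exists x : 'I_m -> k, u.@[x] != 0 /\
    forall g : {mpoly k[m]}, mmap iota xi g = 0 -> g.@[x] = 0.
Proof.
pose xi' i := if insub i is Some i' then xi i' else 0.
have [A [j [rho [x [rj rx pts]]]]] := generic_point iota xi' m.
have rhoE q : rho (mmap j (fun i : 'I_m => x i) q) = mmap iota xi q.
  apply: mmap_rmorph => // i; rewrite rx ?ltn_ord //.
  by rewrite /xi' valK.
rewrite -rhoE => /pts[sigma [sj su sk]].
have sE q : sigma (mmap j (fun i : 'I_m => x i) q) = q.@[fun i => sigma (x i)].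
  exact: (@mmap_rmorph _ _ _ sigma j idfun).
exists (fun i => sigma (x i)); rewrite -sE; split=> // g; rewrite -sE => g0.
by apply: sk; rewrite rhoE.
Qed.

(** * Ultraproducts *)

Section UltraproductTheory.
Variables (I : Type) (U : filter_on I).

Lemma near_forall (J : finType) (P : J -> I -> Prop) :
  (forall j, \forall i \near U, P j i) -> \forall i \near U, forall j, P j i.
Proof.
move=> UP; suff H (r : seq J) : \forall i \near U, forall j, j \in r -> P j i.
  by apply: filterS (H (enum J)) => i Pi j; apply: Pi; rewrite mem_enum.
elim: r => [|j r IH]; first by apply: filterS filterT.
apply: filterS (filterI (UP j) IH) => i [Pj Pr] l.
by rewrite inE => /predU1P[->|/Pr].
Qed.

Section Operations.
Variable A : I -> comPzRingType.
Implicit Types x y : forall i, A i.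

Lemma ulim_of0 : ulim_of U (fun i => 0 : A i) = 0. Proof. by []. Qed.
Lemma ulim_of1 : ulim_of U (fun i => 1 : A i) = 1. Proof. by []. Qed.

Lemma ulim_ofD x y : ulim_of U (fun i => x i + y i) = ulim_of U x + ulim_of U y.
Proof. exact: (rmorphD (qpi (null_ideal U A)) x y). Qed.

Lemma ulim_ofN x : ulim_of U (fun i => - x i) = - ulim_of U x.
Proof. exact: (rmorphN (qpi (null_ideal U A)) x). Qed.

Lemma ulim_ofM x y : ulim_of U (fun i => x i * y i) = ulim_of U x * ulim_of U y.
Proof. exact: (rmorphM (qpi (null_ideal U A)) x y). Qed.

Lemma ulim_ofX x e : ulim_of U (fun i => x i ^+ e) = ulim_of U x ^+ e.
Proof.
elim: e => [|e IH]; first by rewrite expr0.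
rewrite exprS -IH -ulim_ofM; congr ulim_of.
by apply: functional_extensionality_dep => i; rewrite exprS.
Qed.

Lemma ulim_of_sum (J : Type) (r : seq J) (F : J -> forall i, A i) :
  ulim_of U (fun i => \sum_(j <- r) F j i) = \sum_(j <- r) ulim_of U (F j).
Proof.
elim: r => [|j r IH].
  rewrite big_nil -ulim_of0; congr ulim_of.
  by apply: functional_extensionality_dep => i; rewrite big_nil.
rewrite big_cons -IH -ulim_ofD; congr ulim_of.
by apply: functional_extensionality_dep => i; rewrite big_cons.
Qed.

Lemma ulim_of_prod (J : Type) (r : seq J) (F : J -> forall i, A i) :
  ulim_of U (fun i => \prod_(j <- r) F j i) = \prod_(j <- r) ulim_of U (F j).
Proof.
elim: r => [|j r IH].
  rewrite big_nil -ulim_of1; congr ulim_of.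
  by apply: functional_extensionality_dep => i; rewrite big_nil.
rewrite big_cons -IH -ulim_ofM; congr ulim_of.
by apply: functional_extensionality_dep => i; rewrite big_cons.
Qed.

Lemma ulim_of_surj (u : ulim U A) : exists x, u = ulim_of U x.
Proof. by exists (qrepr u); rewrite -[u in LHS]qreprK. Qed.

Lemma ulim_neq0 : ProperFilter U -> (forall i, 1 <> 0 :> A i) -> 1 <> 0 :> ulim U A.
Proof.
move=> PU A10; rewrite -ulim_of0 -ulim_of1 => /ulim_ofP U0.
by have [i /A10] := @filter_ex _ _ PU _ U0.
Qed.

(** Łoś's theorem for ideal powers. It goes through by induction because each level of [ipow] asks
    for a fixed number [n] of coefficients. *)
Lemma ulim_ipow n (t : 'I_n -> forall i, A i) s x :
  ipow (fun l => ulim_of U (t l)) s (ulim_of U x) <->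
  \forall i \near U, ipow (fun l => t l i) s (x i).
Proof.
elim: s x => [|s IH] x /=; first by split=> // _; apply: filterS filterT.
split=> [[b [ib xb]]|Ux].
  have /choice[c bc] l := ulim_of_surj (b l).
  have Uc l : \forall i \near U, ipow (fun l => t l i) s (c l i).
    by apply/IH; rewrite -bc.
  have xc : \forall i \near U, x i = \sum_l c l i * t l i.
    apply/ulim_ofP; rewrite ulim_of_sum xb; apply: eq_bigr => l _.
    by rewrite ulim_ofM -bc.
  apply: filterS (filterI xc (near_forall Uc)) => i [-> ic].
  by exists (fun l => c l i).
(* Witnesses are chosen index by index, with the default 0 at the negligible indices where there are
   none. *)
have ex_c i : exists b : 'I_n -> A i,
    ipow (fun l => t l i) s.+1 (x i) ->
    (forall l, ipow (fun l => t l i) s (b l)) /\ x i = \sum_l b l * t l i.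
  have [[b hb]|no] := pselect (ipow (fun l => t l i) s.+1 (x i)).
    by exists b.
  by exists (fun=> 0).
pose c i := sval (cid (ex_c i)); have hc i := svalP (cid (ex_c i)).
exists (fun l => ulim_of U (fun i => c i l)); split=> [l|].
  by apply/IH; apply: filterS Ux => i /hc[ic _]; apply: ic.
under eq_bigr do rewrite -ulim_ofM.
by rewrite -ulim_of_sum; apply/ulim_ofP; apply: filterS Ux => i /hc[_].
Qed.

End Operations.

Section Map.
Variables (A B : I -> comPzRingType) (f : forall i, {rmorphism A i -> B i}).

Definition ulim_hom (u : ulim U A) : ulim U B := ulim_map (fun i => f i) u.

Lemma ulim_homE x : ulim_hom (ulim_of U x) = ulim_of U (fun i => f i (x i)).
Proof. exact: ulim_mapE. Qed.

Fact ulim_hom_zmod : zmod_morphism ulim_hom.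
Proof.
move=> u v; have [x ->] := ulim_of_surj u; have [y ->] := ulim_of_surj v.
rewrite -ulim_ofN -ulim_ofD !ulim_homE -ulim_ofN -ulim_ofD; congr ulim_of.
by apply: functional_extensionality_dep => i; rewrite rmorphB.
Qed.

Fact ulim_hom_monoid : monoid_morphism ulim_hom.
Proof.
split=> [|u v].
  rewrite -ulim_of1 ulim_homE -ulim_of1; congr ulim_of.
  by apply: functional_extensionality_dep => i; rewrite rmorph1.
have [x ->] := ulim_of_surj u; have [y ->] := ulim_of_surj v.
rewrite -ulim_ofM !ulim_homE -ulim_ofM; congr ulim_of.
by apply: functional_extensionality_dep => i; rewrite rmorphM.
Qed.

HB.instance Definition _ := GRing.isZmodMorphism.Build _ _ ulim_hom ulim_hom_zmod.
HB.instance Definition _ := GRing.isMonoidMorphism.Build _ _ ulim_hom ulim_hom_monoid.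

End Map.
End UltraproductTheory.

Section ToPlus.
Variables (A : comPzRingType) (K : forall H : is_domain A, alg_closure {fraction dom H}).

Fact to_plus_zmod : zmod_morphism (to_plus K).
Proof.
rewrite /to_plus /plus; case: (pselect _) => [H|H] x y //=.
by apply: val_inj; apply: (rmorphB (@to_closure (dom H) (K H))).
Qed.

Fact to_plus_monoid : monoid_morphism (to_plus K).
Proof.
rewrite /to_plus /plus; case: (pselect _) => [H|H] //=; split=> [|x y].
  by apply: val_inj; apply: (rmorph1 (@to_closure (dom H) (K H))).
by apply: val_inj; apply: (rmorphM (@to_closure (dom H) (K H))).
Qed.

HB.instance Definition _ := GRing.isZmodMorphism.Build _ _ (to_plus K) to_plus_zmod.
HB.instance Definition _ := GRing.isMonoidMorphism.Build _ _ (to_plus K) to_plus_monoid.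

End ToPlus.

(** * Localizations of affine algebras *)

Section LocalizationMap.
Variables (A : comPzRingType) (P : ideal A).

Definition loc_emb (a : A) : Loc P := lpi (a, den1 P).

Fact loc_emb_zmod : zmod_morphism loc_emb.
Proof.
move=> x y; rewrite /loc_emb -[RHS]/(ladd _ (lopp _)) loppE laddE.
by apply/lpiP; exists 1; [exact: denom1 | rewrite /=; ring].
Qed.

Fact loc_emb_monoid : monoid_morphism loc_emb.
Proof.
split=> // x y; rewrite /loc_emb -[RHS]/(lmul _ _) lmulE.
by apply/lpiP; exists 1; [exact: denom1 | rewrite /=; ring].
Qed.

HB.instance Definition _ := GRing.isZmodMorphism.Build _ _ loc_emb loc_emb_zmod.
HB.instance Definition _ := GRing.isMonoidMorphism.Build _ _ loc_emb loc_emb_monoid.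

Lemma denom_notin s : ~ P s -> denom P s.
Proof.
move=> Ps; exists [:: s]; last by rewrite big_seq1.
by move=> x; rewrite inE => /eqP->.
Qed.

Lemma frac_mul a s : ~ P s -> Defs.frac P a s * loc_emb s = loc_emb a.
Proof.
move=> /denom_notin Ps; rewrite /loc_emb /Defs.frac -[LHS]/(lmul _ _) lmulE.
apply/lpiP; exists 1; first exact: denom1.
rewrite /fmul; cbn [fst snd]; rewrite !denmulE !den1E insubdK ?mulr1 //.
exact/asboolP.
Qed.

Lemma frac_surj r : prime_ideal P -> exists a s, ~ P s /\ r = Defs.frac P a s.
Proof.
move=> primeP; rewrite -(lreprK r); case: (lrepr r) => a s.
exists a, (val s); split; first by apply/(denom_prime _ primeP); apply: den_val.
by rewrite /Defs.frac valKd.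
Qed.

Lemma loc_emb_eq0 a : loc_emb a = 0 -> exists2 u, denom P u & u * a = 0.
Proof.
case/lpiP => u Pu /=; rewrite !mul0r mulr1 mulr0 => ua.
by exists u.
Qed.

End LocalizationMap.

Section LocalAffineTheory.
Variables (k : fieldType) (m rg rh : nat).
Variables (g : 'I_rg -> {mpoly k[m]}) (h : 'I_rh -> {mpoly k[m]}).

Definition loc_of : {rmorphism {mpoly k[m]} -> loc_aff g h} :=
  (loc_emb (aff_prime g h)) \o (qpi (aff_ideal g)).

Lemma loc_of_gen j : loc_of (g j) = 0.
Proof.
rewrite /loc_of /=.
have -> : qpi (aff_ideal g) (g j) = 0; last exact: rmorph0.
rewrite -[RHS](rmorph0 (qpi (aff_ideal g))); apply/qpiP; rewrite subr0.
exists 1%N, (fun=> 1), (fun=> g j); split=> [i|]; first by exists j.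
by rewrite big_ord1 mul1r.
Qed.

Lemma aff_prime_gen j : aff_prime g h (aff_of g (h j)).
Proof.
exists 1%N, (fun=> 1), (fun=> aff_of g (h j)); split=> [i|]; first by exists j.
by rewrite big_ord1 mul1r.
Qed.

Lemma aff_eq0 f : aff_of g f = 0 ->
  exists (n : nat) (c : 'I_n -> {mpoly k[m]}) (s : 'I_n -> 'I_rg), f = \sum_i c i * g (s i).
Proof.
rewrite -[RHS](rmorph0 (qpi (aff_ideal g))) => /qpiP.
rewrite subr0 => -[n [c [s [gs ->]]]].
have /choice[s' es] i : exists j, g j = s i by have [j _ e] := gs i; exists j.
by exists n, c, s'; apply: eq_bigr => i _; rewrite es.
Qed.

Lemma aff_prime_eval (x : 'I_m -> k) s :
    (forall j, (g j).@[x] = 0) -> (forall j, (h j).@[x] = 0) ->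
  aff_prime g h (aff_of g s) -> s.@[x] = 0.
Proof.
move=> gx hx [n [c [t [ht es]]]].
have /choice[t' et] i : exists j, aff_of g (h j) = t i.
  by have [j _ e] := ht i; exists j.
pose s' := \sum_i qrepr (c i) * h (t' i).
have /aff_eq0[n' [c' [u e]]] : aff_of g (s - s') = 0.
  have -> : aff_of g (s - s') = aff_of g s - aff_of g s' by exact: rmorphB.
  rewrite es /aff_of rmorph_sum; apply/eqP; rewrite subr_eq0; apply/eqP.
  by apply: eq_bigr => i _; rewrite rmorphM -et; congr (_ * _); exact/esym/qreprK.
have -> : s = s' + \sum_i c' i * g (u i) by rewrite -e addrC subrK.
rewrite mevalD !raddf_sum /= !big1 ?addr0 // => i _; rewrite mevalM ?gx ?hx mulr0 //.
Qed.

End LocalAffineTheory.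

Section NullstellensatzPrime.
Variables (k : closedFieldType) (m rg rh : nat).
Variables (g : 'I_rg -> {mpoly k[m]}) (h : 'I_rh -> {mpoly k[m]}).
Hypothesis h_prime : prime_ideal (aff_prime g h).

Let D := Quot (aff_prime g h).

Lemma residue_domain : is_domain D.
Proof.
case: h_prime => P1 PM; split=> [/qpiP|x y]; first by rewrite subr0.
rewrite -(qreprK x) -(qreprK y) -rmorphM -(rmorph0 (qpi (aff_prime g h))).
by move=> /qpiP; rewrite subr0 => /PM[] ?; [left|right]; apply/qpiP; rewrite subr0.
Qed.

(** The Nullstellensatz is applied to the generic point whose coordinates are the classes of the
    variables in the fraction field of the residue domain. *)
Lemma aff_point s : ~ aff_prime g h (aff_of g s) -> exists x : 'I_m -> k,
  [/\ s.@[x] != 0, forall j, (g j).@[x] = 0 & forall j, (h j).@[x] = 0].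
Proof.
move=> Ps.
pose q0 : {rmorphism aff g -> D} := qpi (aff_prime g h).
pose q1 : {rmorphism {mpoly k[m]} -> aff g} := qpi (aff_ideal g).
pose q : {rmorphism {mpoly k[m]} -> dom residue_domain} := q0 \o q1.
pose f : {rmorphism {mpoly k[m]} -> {fraction dom residue_domain}} :=
  (@tofrac (dom residue_domain)) \o q.
pose iota : {rmorphism k -> {fraction dom residue_domain}} := f \o (@mpolyC m k).
have fE p : mmap iota (fun i => f 'X_i) p = f p.
  rewrite [in RHS](mpolyE p) rmorph_sum; apply: eq_bigr => mu _.
  rewrite -mul_mpolyC rmorphM; congr (_ * _).
  rewrite mpolyXE_id rmorph_prod; apply: eq_bigr => i _; rewrite rmorphXn.
  by [].
have f0 p : aff_prime g h (aff_of g p) -> f p = 0.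
  move=> Pp; apply/eqP; rewrite tofrac_eq0; apply/eqP.
  by rewrite -(rmorph0 q0); apply/qpiP; rewrite subr0.
have [|x [sx gx]] := @nullstellensatz k _ iota m (fun i => f 'X_i) s.
  rewrite fE tofrac_eq0; apply/eqP => qs; apply: Ps.
  by move: qs; rewrite -[RHS](rmorph0 q0) => /qpiP; rewrite subr0.
exists x; split=> // j; apply: gx; rewrite fE; apply: f0.
  have -> : aff_of g (g j) = 0; last exact: ideal_0.
  rewrite -[RHS](rmorph0 (qpi (aff_ideal g))); apply/qpiP; rewrite subr0.
  exists 1%N, (fun=> 1), (fun=> g j); split=> [i|]; first by exists j.
  by rewrite big_ord1 mul1r.
exact: aff_prime_gen.
Qed.

End NullstellensatzPrime.

(** * The map to the non-standard hull *)

Section NonTrivial.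
Variables (A : comPzRingType) (A10 : 1 <> 0 :> A).

(* [mmap] requires a nontrivial target ring. *)
Definition nontrivial (_ : 1 <> 0 :> A) : Type := A.
HB.instance Definition _ := GRing.ComPzRing.on (nontrivial A10).
Fact nontrivial_oner_neq0 : (1 : nontrivial A10) != 0.
Proof. exact/eqP. Qed.
HB.instance Definition _ :=
  GRing.PzSemiRing_isNonZero.Build (nontrivial A10) nontrivial_oner_neq0.

Lemma mpoly_hom_exists (B : comNzRingType) (f : {rmorphism B -> A}) m (x : 'I_m -> A) :
  exists T : {rmorphism {mpoly B[m]} -> A}, forall q : {mpoly B[m]},
    T q = \sum_(mu <- msupp q) f q@_mu * \prod_i x i ^+ mu i.
Proof.
pose f' : {rmorphism B -> nontrivial A10} := f.
pose T : {rmorphism {mpoly B[m]} -> nontrivial A10} :=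
  mmap f' (x : 'I_m -> nontrivial A10).
by exists T.
Qed.

End NonTrivial.

Section Approximations.
Variables (C : closedFieldType) (U : filter_on Primes) (PU : ProperFilter U).
Variables (F : forall p : Primes, alg_closure 'F_(val p)).
Variable theta : {rmorphism C -> ulim U (fun p => F p)}.
Variable m : nat.

Lemma approx_mpoly_exists (f : {mpoly C[m]}) : exists f_, approx_mpoly theta f f_.
Proof.
have /choice[c hc] (mu : 'X_{1..m}) : exists c : forall p, F p, approx theta f@_mu c.
  by have [c hc] := ulim_of_surj (theta f@_mu); exists c.
by exists (fun p => \sum_(mu <- msupp f) c mu p *: 'X_[mu]), c.
Qed.

Lemma approx_eval (x : 'I_m -> C) (x_ : 'I_m -> forall p, F p) f f_ :
    (forall i, approx theta (x i) (x_ i)) -> approx_mpoly theta f f_ ->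
  approx theta f.@[x] (fun p => (f_ p).@[fun i => x_ i p]).
Proof.
move=> ax [c [ac fE]]; rewrite /approx.
have -> : (fun p => (f_ p).@[fun i => x_ i p]) =
    (fun p => \sum_(mu <- msupp f) c mu p * \prod_i x_ i p ^+ mu i).
  apply: functional_extensionality_dep => p; rewrite fE raddf_sum.
  by apply: eq_bigr => mu _; rewrite /= mevalZ mevalX.
rewrite ulim_of_sum mevalE rmorph_sum; apply: eq_big_seq => mu fmu.
rewrite ulim_ofM ulim_of_prod rmorphM rmorph_prod (ac _ fmu); congr (_ * _).
by apply: eq_bigr => i _; rewrite ulim_ofX rmorphXn ax.
Qed.

(** Sending coefficients through [theta] and variables to ultraproducts of variables gives a ring
    homomorphism. Hence the ultraproduct of an approximation depends only on [f], and compatibly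
    with the ring operations. *)
Lemma approx_hom_exists :
  exists T : {rmorphism {mpoly C[m]} -> ulim U (fun p => {mpoly (F p)[m]})},
    forall f f_, approx_mpoly theta f f_ -> T f = ulim_of U f_.
Proof.
have nz : 1 <> 0 :> ulim U (fun p => {mpoly (F p)[m]}).
  by apply: ulim_neq0 => // p; apply/eqP/oner_neq0.
pose kappa : {rmorphism ulim U (fun p => F p) -> ulim U (fun p => {mpoly (F p)[m]})} :=
  ulim_hom (fun p => @mpolyC m (F p) : {rmorphism F p -> {mpoly (F p)[m]}}).
have [T TE] := mpoly_hom_exists nz (kappa \o theta : {rmorphism _ -> _})
  (fun i => ulim_of U (fun p => 'X_i : {mpoly (F p)[m]})).
exists T => f f_ [c [ac fE]]; rewrite TE.
have -> : f_ = (fun p => \sum_(mu <- msupp f) (c mu p)%:MP * \prod_i 'X_i ^+ mu i).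
  apply: functional_extensionality_dep => p; rewrite fE; apply: eq_bigr => mu _.
  by rewrite -mul_mpolyC mpolyXE_id.
rewrite ulim_of_sum; apply: eq_big_seq => mu fmu.
rewrite ulim_ofM ulim_of_prod /= (ac _ fmu); congr (_ * _).
  exact: ulim_homE.
by apply: eq_bigr => i _; rewrite ulim_ofX.
Qed.

Variables (rg rh : nat).
Variables (g : 'I_rg -> {mpoly C[m]}) (h : 'I_rh -> {mpoly C[m]}).
Hypothesis h_prime : prime_ideal (aff_prime g h).
Variables (g_ : forall p : Primes, 'I_rg -> {mpoly (F p)[m]}).
Variables (h_ : forall p : Primes, 'I_rh -> {mpoly (F p)[m]}).
Hypothesis g_approx : forall j, approx_mpoly theta (g j) (fun p => g_ p j).
Hypothesis h_approx : forall j, approx_mpoly theta (h j) (fun p => h_ p j).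

Local Notation outside s := (~ aff_prime g h (aff_of g s)).

(* A point of the variety of [(g, h)] where [s] does not vanish has
   approximations with the same property. *)
Lemma approx_outside s s_ : outside s -> approx_mpoly theta s s_ ->
  \forall p \near U, ~ aff_prime (g_ p) (h_ p) (aff_of (g_ p) (s_ p)).
Proof.
move=> /(aff_point h_prime)[x [sx gx hx]] as_.
have /choice[x_ ax] i : exists c : forall p, F p, approx theta (x i) c.
  by have [c hc] := ulim_of_surj (theta (x i)); exists c.
have vanish f f_ : approx_mpoly theta f f_ -> f.@[x] = 0 ->
    \forall p \near U, (f_ p).@[fun i => x_ i p] = 0.
  move=> af fx; apply/ulim_ofP.
  by rewrite ulim_of0 -(rmorph0 theta) -fx; apply/esym/approx_eval.
(* Non-vanishing is expressed by an equation with an inverse, and that equation holds for almost all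
   [p]. *)
have [v hv] := ulim_of_surj (theta s.@[x]^-1).
have s1 : \forall p \near U, (s_ p).@[fun i => x_ i p] * v p = 1.
  apply/ulim_ofP; rewrite ulim_ofM ulim_of1 -hv -(approx_eval ax as_).
  by rewrite -rmorphM divff // rmorph1.
have Ug := near_forall (fun j => vanish _ _ (g_approx j) (gx j)).
have Uh := near_forall (fun j => vanish _ _ (h_approx j) (hx j)).
apply: filterS (filterI s1 (filterI Ug Uh)) => p [sp [gp hp]] /(aff_prime_eval gp hp).
by move=> s0; move: sp; rewrite s0 mul0r => /esym/eqP; rewrite oner_eq0.
Qed.

Variables (R : idomainType) (e : {rmorphism loc_aff g h -> R}).
Hypothesis e_bij : bijective e.

Local Notation HullR := (hull U g_ h_).
Let E f : R := e (loc_of g h f).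

Definition hull_hom (T : {rmorphism {mpoly C[m]} -> ulim U (fun p => {mpoly (F p)[m]})}) :
    {rmorphism {mpoly C[m]} -> HullR} :=
  (ulim_hom (fun p => loc_of (g_ p) (h_ p))) \o T.

Section Graph.
Variable T : {rmorphism {mpoly C[m]} -> ulim U (fun p => {mpoly (F p)[m]})}.
Hypothesis TE : forall f f_, approx_mpoly theta f f_ -> T f = ulim_of U f_.

Let Psi := hull_hom T.

Lemma hull_homE f f_ : approx_mpoly theta f f_ ->
  Psi f = ulim_of U (fun p => loc_of (g_ p) (h_ p) (f_ p)).
Proof. by move=> af; rewrite /Psi /hull_hom /= (TE af); apply: ulim_homE. Qed.

Lemma hull_hom_gen j : Psi (g j) = 0.
Proof.
rewrite (hull_homE (g_approx j)); apply/ulim_ofP; apply: filterS filterT => p _.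
exact: loc_of_gen.
Qed.

Lemma hull_hom_unit s : outside s -> exists v, v * Psi s = 1.
Proof.
move=> Ps; have [s_ as_] := approx_mpoly_exists s.
exists (ulim_of U (fun p => Defs.frac (aff_prime (g_ p) (h_ p)) 1 (aff_of (g_ p) (s_ p)))).
rewrite (hull_homE as_) -ulim_ofM; apply/ulim_ofP.
apply: filterS (approx_outside Ps as_) => p sp.
by rewrite /loc_of /= (frac_mul _ sp) rmorph1.
Qed.

(** If [f] is zero in the localization, then [u f] lies in the ideal generated by [g] for some [u]
    outside the prime; [Psi] kills that ideal and sends [u] to a unit. *)
Lemma hull_hom_ker f : E f = 0 -> Psi f = 0.
Proof.
move=> Ef; have : loc_of g h f = 0.
  by apply: (bij_inj e_bij); rewrite rmorph0.
move=> /loc_emb_eq0[u /(denom_prime _ h_prime) Pu uf].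
have uE : aff_of g (qrepr u) = u by exact: qreprK.
have /aff_eq0[n [c [s cs]]] : aff_of g (qrepr u * f) = 0.
  have -> : aff_of g (qrepr u * f) = aff_of g (qrepr u) * aff_of g f by exact: rmorphM.
  by rewrite uE.
have [|v vu] := @hull_hom_unit (qrepr u); first by rewrite uE.
rewrite -[Psi f]mul1r -vu -mulrA -rmorphM cs rmorph_sum big1 ?mulr0 // => i _.
by rewrite rmorphM hull_hom_gen mulr0.
Qed.

(** Describes [to_hull] by cross-multiplied fractions, so that uniqueness and the ring laws can be
    checked without reference to the chosen approximation. *)
Definition hull_graph (r : R) (x : HullR) : Prop :=
  exists a s, [/\ outside s, r * E s = E a & x * Psi s = Psi a].

Lemma hull_graph_fun r x y : hull_graph r x -> hull_graph r y -> x = y.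
Proof.
move=> [a [s [Ps rs xs]]] [a' [s' [Ps' rs' ys']]].
have : Psi (a * s' - a' * s) = 0.
  apply: hull_hom_ker; rewrite /E !(rmorphB, rmorphM) /= -!/(E _) -rs -rs'.
  by ring.
rewrite rmorphB !rmorphM -xs -ys' => exy.
have [v vs] := hull_hom_unit Ps; have [v' vs'] := hull_hom_unit Ps'.
apply/eqP; rewrite -subr_eq0; apply/eqP.
transitivity ((v * Psi s) * (v' * Psi s') * (x - y)); first by rewrite vs vs' !mul1r.
transitivity (v * v' * (x * Psi s * Psi s' - y * Psi s' * Psi s)); first by ring.
by rewrite exy mulr0.
Qed.

Let outsideM s s' : outside s -> outside s' -> outside (s * s').
Proof.
move=> Ps Ps'; rewrite /aff_of rmorphM => /(proj2 h_prime)[]; [exact: Ps | exact: Ps'].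
Qed.

Lemma hull_graphB r r' x x' :
  hull_graph r x -> hull_graph r' x' -> hull_graph (r - r') (x - x').
Proof.
move=> [a [s [Ps rs xs]]] [a' [s' [Ps' rs' xs']]].
exists (a * s' - a' * s), (s * s'); split; first exact: outsideM.
- by rewrite /E !(rmorphB, rmorphM) /= -!/(E _) -rs -rs'; ring.
- by rewrite !(rmorphB, rmorphM) -xs -xs'; ring.
Qed.

Lemma hull_graphM r r' x x' :
  hull_graph r x -> hull_graph r' x' -> hull_graph (r * r') (x * x').
Proof.
move=> [a [s [Ps rs xs]]] [a' [s' [Ps' rs' xs']]].
exists (a * a'), (s * s'); split; first exact: outsideM.
- by rewrite /E !rmorphM /= -!/(E _) -rs -rs'; ring.
- by rewrite !rmorphM -xs -xs'; ring.
Qed.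

Lemma hull_graph1 : hull_graph 1 1.
Proof.
exists 1, 1; split; rewrite ?mul1r //.
by rewrite /aff_of rmorph1; apply: (proj1 h_prime).
Qed.

Lemma to_hull_graph r : hull_graph r (to_hull theta g_ h_ e r).
Proof.
rewrite /to_hull; set X := [set _ | _ in _].
suff [r_ [a [s [a_ [s_ [aa as_ Ps er rE]]]]] <-] : X (xget 0 X).
  exists a, s; split=> //.
    by rewrite -er /E -rmorphM; congr (e _); apply: frac_mul.
  rewrite (hull_homE aa) (hull_homE as_) -ulim_ofM; apply/ulim_ofP.
  apply: filterS (approx_outside Ps as_) => p sp; rewrite rE.
  exact: frac_mul.
(* The choice is meaningful because every [r] has an approximation: write it as a fraction and
   approximate lifts of numerator and denominator. *)
apply: xgetPex; have [e' eK e'K] := e_bij.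
have [a [s [Ps er]]] := frac_surj (e' r) h_prime.
have [a_ aa] := approx_mpoly_exists (qrepr a).
have [s_ as_] := approx_mpoly_exists (qrepr s).
have sE (b : aff g) : aff_of g (qrepr b) = b by exact: qreprK.
exists (ulim_of U (fun p => loc_frac (g_ p) (h_ p) (a_ p) (s_ p))).
exists (fun p => loc_frac (g_ p) (h_ p) (a_ p) (s_ p)) => //.
exists (qrepr a), (qrepr s), a_, s_; split=> //; first by rewrite sE.
by rewrite /loc_frac !sE -er e'K.
Qed.

End Graph.

Lemma to_hull_zmod : zmod_morphism (to_hull theta g_ h_ e).
Proof.
have [T TE] := approx_hom_exists; move=> r r'.
apply: (hull_graph_fun TE) (to_hull_graph TE _) _.
by apply: hull_graphB; apply: to_hull_graph.
Qed.

Lemma to_hull_monoid : monoid_morphism (to_hull theta g_ h_ e).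
Proof.
have [T TE] := approx_hom_exists; split=> [|r r'].
  by apply: (hull_graph_fun TE) (to_hull_graph TE _) _; apply: hull_graph1.
apply: (hull_graph_fun TE) (to_hull_graph TE _) _.
by apply: hull_graphM; apply: to_hull_graph.
Qed.

Variable K : forall p (H : is_domain (approx_ring g_ h_ p)), alg_closure {fraction dom H}.

Lemma to_BB_hom : exists f : {rmorphism R -> BB U K}, f =1 to_BB theta e K.
Proof.
pose f0 := to_hull theta g_ h_ e.
pose m1 := GRing.isZmodMorphism.Build R HullR f0 to_hull_zmod.
pose m2 := GRing.isMonoidMorphism.Build R HullR f0 to_hull_monoid.
pose f : {rmorphism R -> HullR} := HB.pack f0 m1 m2.
exists ((ulim_hom (fun p => to_plus (@K p) : {rmorphism _ -> _})) \o f).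
by [].
Qed.

End Approximations.

(** * Comparison of ideal powers, and transfer from almost all [p] *)

Section IdealPowersAgree.
Variables (A : comPzRingType) (n : nat) (t : 'I_n -> A).

Lemma gen_ipow x : gen_set (range t) x -> ipow t 1 x.
Proof.
move=> [r [c [s [ts ->]]]]; apply: ipow_sum => i _.
by have [l _ <-] := ts i; apply: ipowMr.
Qed.

Lemma ideal_pow_ipow (J : ideal A) D k x :
  (forall y, J y -> ipow t D y) -> ideal_pow J k x -> ipow t (D * k) x.
Proof.
move=> JD [r [c [s [ss ->]]]]; apply: ipow_sum => i _; apply: ipowMl.
by have [v Jv ->] := ss i; apply: ipow_prod => j; apply: JD.
Qed.

Lemma ideal_powS (J : ideal A) k x y :
  ideal_pow J k x -> J y -> ideal_pow J k.+1 (x * y).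
Proof.
move=> [r [c [s [ss ->]]]] Jy; exists r, c, (fun i => s i * y); split=> [i|].
  have [v Jv ->] := ss i.
  exists (fun j => if unlift ord_max j is Some j' then v j' else y).
    by move=> j; case: (unlift _ _).
  rewrite big_ord_recr /= unlift_none; congr (_ * _); apply: eq_bigr => j _.
  have -> : widen_ord (leqnSn k) j = lift ord_max j.
    by apply: val_inj; rewrite /= /bump leqNgt ltn_ord.
  by rewrite liftK.
by rewrite mulr_suml; apply: eq_bigr => i _; rewrite mulrA.
Qed.

Lemma ideal_pow0 (J : ideal A) x : ideal_pow J 0 x.
Proof.
exists 1%N, (fun=> x), (fun=> 1); split=> [i|]; last by rewrite big_ord1 mulr1.
by exists (fun=> 0) => [[]|]//; rewrite big_ord0.
Qed.

Lemma ipow_ideal_ext (B : comPzRingType) (f : {rmorphism A -> B}) (J : ideal A) k y :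
  (forall l, J (t l)) -> ipow (f \o t) k y -> ideal_ext f (ideal_pow J k) y.
Proof.
move=> Jt; elim: k y => [|k IH] y /=.
  move=> _; exists 1%N, (fun=> y), (fun=> f 1); split=> [i|].
    by exists 1 => //; apply: ideal_pow0.
  by rewrite big_ord1 rmorph1 mulr1.
move=> [b [ib ->]].
suff H l : ideal_ext f (ideal_pow J k.+1) (b l * f (t l)).
  apply: (big_ind (ideal_ext f (ideal_pow J k.+1))) => //.
  - exact: ideal_0.
  - exact: ideal_D.
have [r [c [s [ss ->]]]] := IH _ (ib l).
exists r, c, (fun i => s i * f (t l)); split=> [i|].
  have [x Jx <-] := ss i; exists (x * t l); last exact: rmorphM.
  exact: ideal_powS.
by rewrite mulr_suml; apply: eq_bigr => i _; rewrite mulrA.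
Qed.

End IdealPowersAgree.

Lemma approx_ring_pchar (p : Primes) (F : alg_closure 'F_(val p)) m rg rh
    (g : 'I_rg -> {mpoly F[m]}) (h : 'I_rh -> {mpoly F[m]}) :
  (val p)%:R = 0 :> loc_aff g h.
Proof.
have F0 : (val p)%:R = 0 :> F.
  by rewrite -(rmorph_nat (ac_emb F)) (pcharf0 (pchar_Fp (valP p))) rmorph0.
by rewrite -(rmorph_nat (loc_of g h)) -(rmorph_nat (@mpolyC m F)) F0 !rmorph0.
Qed.

Theorem theorem2 (Re : realType)
  (* the ultrafilter, the fields F_p^alg, and C = ulim F_p^alg *)
  (U : filter_on Primes) (U_ultra : UltraFilter (filter U))
  (U_nonprincipal : forall p : Primes, ~ (\forall q \near U, q = p))
  (Fbar : forall p : Primes, alg_closure 'F_(val p))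
  (theta : {rmorphism Re[i] -> ulim U (fun p => Fbar p)})
  (theta_bij : bijective theta)
  (* the local affine domain R, presented by (C[X] / (g))_(h) *)
  (m rg rh : nat)
  (g : 'I_rg -> {mpoly Re[i][m]}) (h : 'I_rh -> {mpoly Re[i][m]})
  (h_prime : prime_ideal (aff_prime g h))
  (R : idomainType) (e : {rmorphism loc_aff g h -> R}) (e_bij : bijective e)
  (* approximations of the two ideals, defining R_p *)
  (g_ : forall p : Primes, 'I_rg -> {mpoly (Fbar p)[m]})
  (h_ : forall p : Primes, 'I_rh -> {mpoly (Fbar p)[m]})
  (g_approx : forall j, approx_mpoly theta (g j) (fun p => g_ p j))
  (h_approx : forall j, approx_mpoly theta (h j) (fun p => h_ p j))
  (* algebraic closures of the fraction fields, defining R_p^+ *)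
  (K : forall (p : Primes) (H : is_domain (approx_ring g_ h_ p)),
    alg_closure {fraction dom H})
  (n : nat) (n_gt0 : (0 < n)%N) (I : ideal R) (t : 'I_n -> R)
  (I_gen : ideal_set I = ideal_gen (range t)) (k : nat) :
  integral_closure (ideal_pow I (n + k)) `<=`
    to_BB theta e K @^-1`
      ideal_set (ideal_ext (to_BB theta e K) (ideal_pow I k.+1)).
Proof.
have PU : ProperFilter U by apply: ultra_proper.
have [tau tauE] := to_BB_hom PU h_prime g_approx h_approx e_bij K.
have -> : to_BB theta e K = tau by apply: funext => x; rewrite tauE.
move=> z [d [a [d_gt0 Ia ez]]].
have It l : I (t l).
  rewrite I_gen; exists 1%N, (fun=> 1), (fun=> t l); split=> [i|]; first by exists l.
  by rewrite big_ord1 mul1r.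
(* From here on everything is stated with [ipow], the form that passes through ultraproducts. *)
suff iz : ipow (tau \o t) k.+1 (tau z) by apply: ipow_ideal_ext.
have ia i : (1 <= i <= d)%N -> ipow (tau \o t) ((n + k) * i) (tau (- a i)).
  move=> id; apply: (ipow_map (t := t)) => //; rewrite -mulN1r; apply: ipowMl.
  (* Two nested powers occur: [a i] lies in the [i]-th power of [I^(n + k)], hence in degree
     [(n + k) * i]. *)
  apply: ideal_pow_ipow (Ia i id) => y; rewrite -[X in ipow t X y]mul1n.
  by apply: ideal_pow_ipow => x; rewrite I_gen => /gen_ipow.
have {}ez : z ^+ d = \sum_(1 <= i < d.+1) (- a i) * z ^+ (d - i).
  move/eqP: ez; rewrite addr_eq0 => /eqP->; rewrite -sumrN.
  by apply: eq_bigr => i _; rewrite mulNr.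
have /choice[t_ tE] l := ulim_of_surj (tau (t l)).
have /choice[a_ aE] i := ulim_of_surj (tau (- a i)).
have [z_ zE] := ulim_of_surj (tau z).
have tauT : tau \o t = fun l => ulim_of U (t_ l) by apply: funext => l; rewrite -tE.
rewrite tauT in ia *; rewrite zE; apply/ulim_ipow.
(* Only the finitely many coefficients with index at most [d] matter, so one set of primes in [U]
   serves for all of them. *)
have Ua (i : 'I_d.+1) : \forall p \near U, (1 <= i <= d)%N ->
    ipow (fun l => t_ l p) ((n + k) * i) (a_ i p).
  have [/ia|] := boolP (1 <= i <= d)%N; last by move=> _; apply: filterS filterT.
  by rewrite aE => /ulim_ipow; apply: filterS.
have Uz : \forall p \near U,
    z_ p ^+ d = \sum_(1 <= i < d.+1) a_ i p * z_ p ^+ (d - i).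
  apply/ulim_ofP; rewrite ulim_ofX -zE -rmorphXn ez rmorph_sum ulim_of_sum.
  by apply: eq_bigr => i _; rewrite ulim_ofM ulim_ofX -zE -aE rmorphM rmorphXn.
apply: filterS (filterI Uz (near_forall Ua)) => p [pz pa].
apply: (plus_briancon_skoda (valP p) _ n_gt0) pz.
  exact: approx_ring_pchar.
move=> i id; have /andP[_ id'] := id.
exact: (pa (Ordinal (id' : i < d.+1)%N)).
Qed.
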